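(* For all $p\in[2,\infty)$ and $n\in\mathbb N$ there exists $\alpha_0(n,p)>0$ such that the following holds. Let $\Omega$ be a smooth $n$-dimensional manifold and $(\Omega^n,\ell(t))_{t\in(0,T]}$ a smooth solution to Ricci flow satisfying $$\int_\Omega|\mathrm{Rc}(\ell(t))|\,d\ell(t)\le\varepsilon,\qquad |\mathrm{Rc}(\ell(t))|\le\frac\varepsilon t\ \text{ on }\Omega$$ for all $t\in(0,T]$, where $\varepsilon\le\alpha_0$. Then there exists a unique, positive definite, symmetric two-tensor $\ell_0\in L^p$ such that $\ell(s)\to\ell_0$ in $L^p(\Omega)$ as $s\downarrow0$ and $\ell^{-1}(s)\to(\ell_0)^{-1}$ in $L^p(\Omega)$ as $s\downarrow0$.
   Context: A smooth family $\ell(t)$ of Riemannian metrics solves Ricci flow if $\partial_t\ell=-2\mathrm{Rc}(\ell)$, where $\mathrm{Rc}(\ell)$ is the Ricci curvature of $\ell$. The norm $|\mathrm{Rc}(\ell(t))|$ is taken with respect to $\ell(t)$, and $d\ell(t)$ is the volume measure of $\ell(t)$. $L^p(\Omega)$ for tensors is understood with respect to the norm and measure of $\ell(t)$ for a fixed $t\in(0,T]$. $\ell_0$ is determined up to sets of measure zero.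
   Formalization: When Ω has infinite volume (e.g. static flat R^n, where ℓ_0 = δ), ℓ_0 cannot lie in L^p(Ω), so membership of ℓ_0 in L^p is asserted on every Borel set of finite volume (all of Ω if its volume is finite); both convergences are in L^p(Ω) as stated. *)

(* Defs.v *)
From HB Require Import structures.
From mathcomp Require Import all_boot all_order all_algebra.
From mathcomp Require Import all_classical all_reals all_analysis.
Set Implicit Arguments.
Unset Strict Implicit.
Unset Printing Implicit Defensive.
Import Order.TTheory GRing.Theory Num.Theory.
Import numFieldNormedType.Exports.
Local Open Scope classical_set_scope.
Local Open Scope ring_scope.

Section EuclideanSpace.
Context {R : realType}.

Definition basis_vec {n} (j : 'I_n) : 'rV[R]_n := delta_mx 0 j.

(* All partial derivatives of order exactly k exist and are continuous on U. *)
Fixpoint Ck_on {n} (k : nat) (U : set 'rV[R]_n) (f : 'rV[R]_n -> R) : Prop :=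
  match k with
  | 0 => forall x, U x -> {for x, continuous f}
  | k'.+1 => forall j : 'I_n,
      (forall x, U x -> derivable f x (basis_vec j)) /\
      Ck_on k' U (fun x => 'D_(basis_vec j) f x)
  end.

(* Smoothness on an arbitrary subset A: f extends, near each point of A, to a
   C^infty function on an open set.  For open A this is plain C^infty; the
   general form is needed for the time interval ]0, T], closed on the right. *)
Definition smooth_on {n} (A : set 'rV[R]_n) (f : 'rV[R]_n -> R) : Prop :=
  forall x, A x -> exists (U : set 'rV[R]_n) (F : 'rV[R]_n -> R),
    [/\ open U, U x, (forall k, Ck_on k U F)
      & forall y, A y -> U y -> F y = f y].

(* n-dimensional Lebesgue integral of a nonnegative Borel function, written as
   an iterated integral (Tonelli). *)
Fixpoint lebesgue_int {n} : ('rV[R]_n -> \bar R) -> \bar R :=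
  match n return ('rV[R]_n -> \bar R) -> \bar R with
  | 0 => fun f => f 0
  | m.+1 => fun f =>
      (\int[@lebesgue_measure R]_x
         lebesgue_int (fun y : 'rV[R]_m => f (row_mx x%:M y : 'rV[R]_(1 + m))))%E
  end.

Definition posdef {n} (S : 'M[R]_n) : Prop :=
  S^T = S /\ forall v : 'rV[R]_n, v != 0 -> 0 < (v *m S *m v^T) 0 0.

(* Norms with respect to the inner product G of a (0,2)-tensor A,
   |A|^2 = G^{ik} G^{jl} A_ij A_kl, and of a (2,0)-tensor B,
   |B|^2 = G_ik G_jl B^ij B^kl. *)
Definition co_norm {n} (G A : 'M[R]_n) : R :=
  Num.sqrt (\tr (invmx G *m A *m invmx G *m A^T)).
Definition contra_norm {n} (G B : 'M[R]_n) : R :=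
  Num.sqrt (\tr (G *m B *m G *m B^T)).

Section CoordinateRicci.
Context {n : nat} (G : 'rV[R]_n -> 'M[R]_n).

Definition pd (j : 'I_n) (f : 'rV[R]_n -> R) (y : 'rV[R]_n) : R :=
  'D_(basis_vec j) f y.

(* Gamma^k_ab *)
Definition christoffel (k a b : 'I_n) (y : 'rV[R]_n) : R :=
  2^-1 * \sum_(l < n) invmx (G y) k l *
    (pd a (fun z => G z b l) y + pd b (fun z => G z a l) y
     - pd l (fun z => G z a b) y).

Definition coord_ricci (y : 'rV[R]_n) : 'M[R]_n := \matrix_(a, b)
  (\sum_(k < n) (pd k (christoffel k a b) y - pd b (christoffel k a k) y)
   + \sum_(k < n) \sum_(l < n)
       (christoffel k k l y * christoffel l a b y
        - christoffel k b l y * christoffel l a k y)).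

End CoordinateRicci.
End EuclideanSpace.

(* A smooth n-manifold structure (without boundary) on M, given by an atlas.
   [chart_at] picks one chart around each point. *)
Record smooth_manifold (R : realType) (n : nat) (M : ptopologicalType) := {
  hausdorff_manifold : hausdorff_space M;
  second_countable_manifold : @second_countable M;
  chart : Type;
  dom : chart -> set M;
  coord : chart -> M -> 'rV[R]_n;
  param : chart -> 'rV[R]_n -> M;
  chart_at : M -> chart;
  dom_chart_at : forall x, dom (chart_at x) x;
  open_dom : forall i, open (dom i);
  open_image : forall i, open (coord i @` dom i);
  coordK : forall i x, dom i x -> param i (coord i x) = x;
  coord_continuous : forall i, {within dom i, continuous (coord i)};
  param_continuous : forall i, {within coord i @` dom i, continuous (param i)};
  transition_smooth : forall i j (a : 'I_n),
    smooth_on (coord i @` (dom i `&` dom j))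
      (fun y => coord j (param i y) 0 a) }.

Arguments chart {R n M} X : rename.
Arguments dom {R n M} X i _ : rename.
Arguments coord {R n M} X i _ : rename.
Arguments param {R n M} X i _ : rename.
Arguments chart_at {R n M} X _ : rename.

Notation borel M := (g_sigma_algebraType (@open M)).

Section Manifold.
Context {R : realType} {n : nat} {M : ptopologicalType}.
Variable X : smooth_manifold R n M.

(* Components, in every chart, of a field of 2-tensors.  Only the values of
   component [i] on [dom X i] are meaningful. *)
Definition components := chart X -> M -> 'M[R]_n.
Implicit Types (g h : components).

(* Transformation law of the components of a (0,2)-tensor; the library's
   Jacobian is (J)_(a,c) = d y_j^c / d y_i^a. *)
Definition covariant2 h : Prop := forall i j x, dom X i x -> dom X j x ->
  let J := 'J (coord X j \o param X i) (coord X i x) in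
  h i x = J *m h j x *m J^T.

Definition measurable_components h : Prop :=
  forall i (a b : 'I_n),
    measurable_fun (dom X i : set (borel M)) (fun x : borel M => h i x a b).

Definition riemannian_metric g : Prop :=
  [/\ covariant2 g,
      (forall i (a b : 'I_n), smooth_on (coord X i @` dom X i)
                                (fun y => g i (param X i y) a b))
    & forall i x, dom X i x -> posdef (g i x)].

Definition ricci g : components := fun i x =>
  coord_ricci (fun y => g i (param X i y)) (coord X i x).

(* Components of the (2,0)-tensor inverse to h. *)
Definition inv_tensor h : components := fun i x => invmx (h i x).

Definition sub_tensor g h : components := fun i x => g i x - h i x.

Definition co_norm_at g h (x : M) : R :=
  co_norm (g (chart_at X x) x) (h (chart_at X x) x).
Definition contra_norm_at g h (x : M) : R :=
  contra_norm (g (chart_at X x) x) (h (chart_at X x) x).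

(* mu is the Riemannian volume measure of g: sqrt (det g) dy in every chart.
   This determines mu, as M is covered by countably many charts. *)
Definition volume_measure g (mu : {measure set (borel M) -> \bar R}) : Prop :=
  forall i (A : set (borel M)), measurable A -> A `<=` dom X i ->
    mu A = lebesgue_int
      ((fun y => (Num.sqrt (\det (g i (param X i y))))%:E)
         \_ (coord X i @` A)).

(* (l t), 0 < t <= T, is a smooth solution to Ricci flow; the time derivative
   is one-sided at t = T. *)
Definition ricci_flow (T : R) (l : R -> components) : Prop :=
  [/\ (forall t, 0 < t <= T -> riemannian_metric (l t)),
      (forall i (a b : 'I_n),
         smooth_on [set z : 'rV[R]_(1 + n) |
                      0 < lsubmx z 0 0 <= T /\ (coord X i @` dom X i) (rsubmx z)]
           (fun z => l (lsubmx z 0 0) i (param X i (rsubmx z)) a b))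
    & forall t, 0 < t <= T -> forall i x, dom X i x ->
        (s - t)^-1 *: (l s i x - l t i x)
          @[s --> within [set s | 0 < s <= T] (t^')]
        --> - (2 *: ricci (l t) i x)].

(* h is an L^p initial value of the flow l, with L^p taken with respect to the
   metric g and its volume measure mu.  A uniformly positive definite tensor
   has infinite L^p norm on a set of infinite volume, so membership of h in L^p
   is asked for on all Borel sets of finite volume (hence on the whole manifold
   if its volume is finite); the convergences are in L^p of the whole
   manifold. *)
Definition Lp_initial_value (p : R) (l : R -> components) g
    (mu : {measure set (borel M) -> \bar R}) h : Prop :=
  [/\ covariant2 h /\ measurable_components h,
      {ae mu, forall x, posdef (h (chart_at X x) x)},
      (forall A : set (borel M), measurable A -> (mu A < +oo)%E ->
         finite_norm mu p%:E (co_norm_at g h \_ A)),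
      'N[mu]_(p%:E)[EFin \o co_norm_at g (sub_tensor (l s) h)]%E
        @[s --> 0^'+] --> 0%E
    & 'N[mu]_(p%:E)[EFin \o contra_norm_at g
                      (sub_tensor (inv_tensor (l s)) (inv_tensor h))]%E
        @[s --> 0^'+] --> 0%E].

End Manifold.

(* Main.v *)
Require Import Defs.
From HB Require Import structures.
From mathcomp Require Import all_boot all_order all_algebra.
From mathcomp Require Import all_classical all_reals all_analysis.
From mathcomp Require Import measurable_realfun.
From mathcomp Require Import ring lra.
Set Implicit Arguments.
Unset Strict Implicit.
Unset Printing Implicit Defensive.
Import Order.TTheory GRing.Theory Num.Theory.
Import numFieldNormedType.Exports.
Local Open Scope classical_set_scope.
Local Open Scope ring_scope.

(** The heart of the matter is that the metrics form a Cauchy family in L^p, at a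
    geometric rate along the times [T / 4 ^+ k].  Write [al] for a common bound of
    the two curvature hypotheses; its size is fixed at the end by an exponent count.

    Pointwise control.  The flow equation, in each chart, says that the time
    derivative of the metric is [-2 ric]; hence the Ricci components transform as a
    tensor ([ricci_transforms]), and the bound [al / t] with Gronwall's inequality
    makes [l r] and [l t] comparable in the Loewner order up to the factor
    [(t / r) `^ (2 * al)] ([flow_loewner]), and their volumes up to
    [(t / r) `^ (al * n)] ([flow_volume_le]).  These factors blow up as [r] tends to
    [0], but as slowly as desired.  They allow all norms to be measured with the
    single metric [l T].

    Integral control.  Interpolating between the L^1 bound and the pointwise bound
    gives [|ric|_p = O(t `^ (p^-1 - 1))], up to such slow factors
    ([ricci_Lnorm_le]).  Integrating in time from [r] to [s <= 4 * r] gains a factor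
    [r], whence [|l s - l r|_p = O(r `^ (2 * p)^-1)] ([deviation_Lnorm_le]).  The
    time integral is taken through Riemann sums, Minkowski's inequality and Fatou's
    lemma.  Since [A^-1 - B^-1 = A^-1 (B - A) B^-1], the inverse metrics satisfy the
    same estimate at the cost of one more slow factor ([contra_norm_le_deviation]).

    Passage to the limit.  The steps between consecutive quarter times are
    geometrically small in L^p, so off a null set their sums lie below one function
    of L^p ([Lnorm_series_majorant]).  Where this happens, the metrics converge
    entrywise, and so do their inverses, which keeps the limit positive definite
    ([posdef_mx_lim]); the majorants of the tails, whose p-norms tend to [0], turn
    this into convergence in L^p ([initial_tensor_Lp]).  Comparability of the
    metrics transfers the conclusion from [T] to every other reference time
    ([Lp_initial_value_transfer]), and uniqueness is that of limits in L^p
    ([Lp_initial_value_unique]). *)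

(** * Inner products and norms of matrices *)

Section MatrixNorms.
Context {R : realType}.

Definition qform {n} (A : 'M[R]_n) (v : 'rV[R]_n) : R := (v *m A *m v^T) 0 0.

Lemma qformB n (A B : 'M[R]_n) v : qform (A - B) v = qform A v - qform B v.
Proof. by rewrite /qform mulmxBr mulmxBl mxE [X in _ + X]mxE. Qed.

Lemma qformZ n c (A : 'M[R]_n) v : qform (c *: A) v = c * qform A v.
Proof. by rewrite /qform -scalemxAr -scalemxAl mxE. Qed.

Lemma qform_congr m n (P : 'M[R]_(m, n)) (A : 'M[R]_n) v :
  qform (P *m A *m P^T) v = qform A (v *m P).
Proof. by rewrite /qform trmx_mul !mulmxA. Qed.

Lemma scalar_mx11 (x : R) : (x%:M : 'M[R]_1) 0 0 = x.
Proof. by rewrite mxE eqxx. Qed.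

Lemma invmx_mul n (A B : 'M[R]_n) : A \in unitmx -> B \in unitmx ->
  invmx (A *m B) = invmx B *m invmx A.
Proof.
move=> uA uB; have uAB : A *m B \in unitmx by rewrite unitmx_mul uA.
by rewrite -[RHS](mulKmx uAB) -mulmxA mulKVmx// mulmxV// mulmx1.
Qed.

Lemma qform_delta n (A : 'M[R]_n) i : qform A (delta_mx 0 i) = A i i.
Proof.
rewrite /qform -rowE mxE (bigD1 i)//= !mxE !eqxx mulr1 big1 ?addr0// => j ji.
by rewrite !mxE (negbTE ji) mulr0.
Qed.

Lemma posdef_qform_ge0 n (G : 'M[R]_n) v : posdef G -> 0 <= qform G v.
Proof.
move=> [_ Gp]; have [->|/Gp/ltW//] := eqVneq v 0.
by rewrite /qform !mul0mx mxE.
Qed.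

(** Cholesky factorization, by induction through the Schur complement.  It
    reduces every statement about the norms defined by [G] to [G = 1]; the
    triangular shape is what controls determinants. *)
Lemma posdef_cholesky n (G : 'M[R]_n) : posdef G ->
  exists P : 'M[R]_n, [/\ is_trig_mx P, P \in unitmx & G = P *m P^T].
Proof.
elim: n G => [|n IH] G.
  move=> _; exists 1%:M; split; [by apply/is_trig_mxP => -[]|exact: unitmx1|].
  by rewrite [LHS]flatmx0 [RHS]flatmx0.
rewrite -[n.+1]/(1 + n)%N in G *.
rewrite -[G]submxK.
set a := ulsubmx G; set b := ursubmx G; set c := dlsubmx G; set d := drsubmx G.
move=> [sG pG].
move: sG; rewrite tr_block_mx => /eq_block_mx[_ cb bc sd].
have Ea : a = (a 0 0)%:M.
  by apply/matrixP => i j; rewrite !ord1 !mxE eqxx mulr1n.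
have qE (x : 'M[R]_1) (v : 'rV[R]_n) :
    qform (block_mx a b c d) (row_mx x v) =
    a 0 0 * (x 0 0) ^+ 2 + 2 * x 0 0 * (b *m v^T) 0 0 + qform d v.
  rewrite /qform mul_row_block tr_row_mx mul_row_col !mulmxDl [LHS]mxE.
  rewrite [in LHS]mxE [X in _ + X]mxE.
  have -> : v *m c *m x^T = (x *m (b *m v^T))^T.
    by rewrite !trmx_mul trmxK bc.
  rewrite [X in _ + X + _]mxE -!mulmxA [(x *m (b *m v^T)) 0 0]mxE big_ord1.
  rewrite [(x *m _) 0 0]mxE big_ord1 [(a *m _) 0 0]mxE big_ord1 [x^T 0 0]mxE.
  have -> : (ord0 : 'I_1) = 0 by exact: val_inj.
  by ring.
have a0 : 0 < a 0 0.
  have := pG (row_mx 1%:M 0).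
  rewrite -/(qform _ _) qE trmx0 mulmx0 !mxE /qform mul0mx mul0mx mxE.
  rewrite mulr0 !addr0 expr1n mulr1; apply.
  apply/eqP => /matrixP/(_ 0 (lshift n 0)); rewrite row_mxEl !mxE eqxx.
  by apply/eqP; exact: oner_neq0.
pose S : 'M[R]_n := d - (a 0 0)^-1 *: (c *m b).
have cbE v : qform (c *m b) v = ((b *m v^T) 0 0) ^+ 2.
  rewrite /qform mulmxA -mulmxA [LHS]mxE big_ord1 -[v *m c]trmxK trmx_mul cb.
  by rewrite mxE expr2.
(* The form of the Schur complement at [v] is that of [G] at [v] corrected by a
   multiple of the first vector, chosen to minimize it. *)
have /IH[Q [tQ uQ SQ]] : posdef S.
  split.
    by rewrite /S linearB/= linearZ/= trmx_mul bc cb sd.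
  move=> v v0; rewrite -/(qform S v).
  have := pG (row_mx (- ((b *m v^T) 0 0 / a 0 0))%:M v).
  rewrite -/(qform _ _) qE scalar_mx11.
  rewrite /S qformB qformZ cbE => H.
  suff : 0 < a 0 0 * (- ((b *m v^T) 0 0 / a 0 0)) ^+ 2 +
    2 * (- ((b *m v^T) 0 0 / a 0 0)) * (b *m v^T) 0 0 + qform d v.
    by congr (0 < _); field; rewrite gt_eqF.
  apply: H; apply: contra v0 => /eqP/matrixP v0.
  by apply/eqP/matrixP => i j; rewrite -(row_mxEr (- ((b *m v^T) 0 0 / a 0 0))%:M v) v0 !mxE.
pose s := Num.sqrt (a 0 0).
have s0 : 0 < s by rewrite sqrtr_gt0.
exists (block_mx s%:M 0 (s^-1 *: c) Q); split.
- by rewrite is_trig_block_mx// eqxx/= tQ andbT mx11_is_trig.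
- by rewrite unitmxE det_lblock det_scalar1 unitrM unitfE gt_eqF//= -unitmxE.
- rewrite tr_block_mx trmx0 mulmx_block !mulmx0 !mul0mx !addr0.
  rewrite tr_scalar_mx -scalar_mxM -expr2 sqr_sqrtr ?ltW// -Ea.
  rewrite linearZ/= cb -!scalemxAr -!scalemxAl -SQ mul_scalar_mx mul_mx_scalar.
  rewrite !scalerA mulVf ?gt_eqF// !scale1r.
  congr block_mx; rewrite /S -invfM -expr2 sqr_sqrtr ?ltW//.
  by rewrite addrC subrK.
Qed.

Lemma posdef_unit n (G : 'M[R]_n) : posdef G -> G \in unitmx.
Proof.
by move=> /posdef_cholesky[P [_ uP ->]]; rewrite unitmx_mul uP unitmx_tr.
Qed.

Lemma mul_tr_posdef n (P : 'M[R]_n) : P \in unitmx -> posdef (P *m P^T).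
Proof.
move=> uP; split; first by rewrite trmx_mul trmxK.
move=> v v0; rewrite mulmxA -mulmxA -trmx_mul mxE lt_neqAle.
under eq_bigr do rewrite [_^T _ _]mxE -expr2.
rewrite sumr_ge0 ?andbT => [|i _]; last exact: sqr_ge0.
apply: contra v0; rewrite eq_sym psumr_eq0 => [|i _]; last exact: sqr_ge0.
move=> /allP z; have vP : v *m P = 0.
  apply/matrixP => i j; rewrite ord1 [RHS]mxE; apply/eqP.
  by have := z j (mem_index_enum j); rewrite sqrf_eq0.
by rewrite -(mulmxK uP v) vP mul0mx.
Qed.

Lemma invmx_congr n (P A : 'M[R]_n) : P \in unitmx -> A \in unitmx ->
  invmx (P *m A *m P^T) = (invmx P)^T *m invmx A *m invmx P.
Proof.
move=> uP uA; rewrite !invmx_mul ?unitmx_mul ?unitmx_tr ?uP//.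
by rewrite trmx_inv mulmxA.
Qed.

Lemma posdef_inv n (G : 'M[R]_n) : posdef G -> posdef (invmx G).
Proof.
move=> /posdef_cholesky[P [_ uP ->]]; rewrite invmx_mul ?unitmx_tr// -trmx_inv.
rewrite -{2}[invmx P]trmxK; apply: mul_tr_posdef.
by rewrite unitmx_tr unitmx_inv.
Qed.

Lemma contra_normE n (G B : 'M[R]_n) : contra_norm G B = co_norm (invmx G) B.
Proof. by rewrite /contra_norm /co_norm invmxK. Qed.

(** The norm of a tensor does not depend on the chart in which it is computed. *)
Lemma co_norm_congr n (P G A : 'M[R]_n) : P \in unitmx -> G \in unitmx ->
  co_norm (P *m G *m P^T) (P *m A *m P^T) = co_norm G A.
Proof.
move=> uP uG; rewrite /co_norm invmx_congr//; congr Num.sqrt.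
rewrite !trmx_mul trmxK -!mulmxA mxtrace_mulC !mulmxA.
have uPT : P^T \in unitmx by rewrite unitmx_tr.
by rewrite trmx_inv !(mulmxKV uP) !(mulmxK uPT).
Qed.

Lemma co_norm_ge0 n (G A : 'M[R]_n) : 0 <= co_norm G A.
Proof. exact: sqrtr_ge0. Qed.

Lemma co_norm0 n (G : 'M[R]_n) : co_norm G 0 = 0.
Proof. by rewrite /co_norm !mulmx0 !mul0mx mxtrace0 sqrtr0. Qed.

Section StandardInnerProduct.
Context {m n : nat}.
Implicit Types A B : 'M[R]_(m, n).

Definition mxdot A B : R := \tr (A *m B^T).

Lemma mxdotE A B : mxdot A B = \sum_i \sum_j A i j * B i j.
Proof.
apply: eq_bigr => i _; rewrite mxE; apply: eq_bigr => j _.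
by rewrite mxE.
Qed.

Lemma mxdot_ge0 A : 0 <= mxdot A A.
Proof.
by rewrite mxdotE sumr_ge0// => i _; rewrite sumr_ge0// => j _; rewrite -expr2 sqr_ge0.
Qed.

Lemma mxdot_eq0 A : mxdot A A = 0 -> A = 0.
Proof.
rewrite mxdotE => /eqP; rewrite psumr_eq0 => [/allP z|i _]; last first.
  by rewrite sumr_ge0// => j _; rewrite -expr2 sqr_ge0.
apply/matrixP => i j; rewrite mxE.
have := z i (mem_index_enum i); rewrite psumr_eq0 => [/allP y|k _]; last first.
  by rewrite -expr2 sqr_ge0.
by have := y j (mem_index_enum j); rewrite -expr2 sqrf_eq0 => /eqP.
Qed.

Lemma mxdotC A B : mxdot A B = mxdot B A.
Proof. by rewrite /mxdot -mxtrace_tr trmx_mul trmxK. Qed.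

Lemma mxdotDl A B C : mxdot (A + B) C = mxdot A C + mxdot B C.
Proof. by rewrite /mxdot mulmxDl mxtraceD. Qed.

Lemma mxdotZl c A B : mxdot (c *: A) B = c * mxdot A B.
Proof. by rewrite /mxdot -scalemxAl mxtraceZ. Qed.

Lemma mxdot_CauchySchwarz A B : mxdot A B ^+ 2 <= mxdot A A * mxdot B B.
Proof.
have [B0|B0] := eqVneq (mxdot B B) 0.
  have -> : B = 0 by exact: mxdot_eq0.
  by rewrite /mxdot trmx0 !mulmx0 mxtrace0 expr0n mulr0.
have Bp : 0 < mxdot B B by rewrite lt_neqAle eq_sym B0 mxdot_ge0.
have := mxdot_ge0 (mxdot B B *: A + (- mxdot A B) *: B).
rewrite mxdotDl !mxdotZl ![mxdot _ (_ + _)]mxdotC !mxdotDl !mxdotZl.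
rewrite [mxdot B A]mxdotC.
have -> : forall a b c : R, b * (b * a + - c * c) + - c * (b * c + - c * b) =
  b * (a * b - c ^+ 2) by move=> *; ring.
by rewrite pmulr_rge0// subr_ge0.
Qed.

End StandardInnerProduct.

Lemma co_norm1E n (A : 'M[R]_n) : co_norm 1%:M A = Num.sqrt (mxdot A A).
Proof. by rewrite /co_norm invmx1 mul1mx mulmx1. Qed.

Lemma co_norm_cholesky n (P A : 'M[R]_n) : P \in unitmx ->
  co_norm (P *m P^T) (P *m A *m P^T) = Num.sqrt (mxdot A A).
Proof.
by move=> uP; rewrite -co_norm1E -{1}[P]mulmx1 co_norm_congr// unitmx1.
Qed.

Lemma congr_unit_surj n (P A : 'M[R]_n) : P \in unitmx ->
  A = P *m (invmx P *m A *m invmx P^T) *m P^T.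
Proof. by move=> uP; rewrite -!mulmxA mulVmx ?unitmx_tr// mulmx1 mulKVmx. Qed.

Lemma co_normZ n (G A : 'M[R]_n) c : co_norm G (c *: A) = `|c| * co_norm G A.
Proof.
rewrite /co_norm.
have -> : (c *: A)^T = c *: A^T by rewrite linearZ.
rewrite -!scalemxAr -!scalemxAl scalerA mxtraceZ.
by rewrite -expr2 sqrtrM ?sqr_ge0// sqrtr_sqr.
Qed.

Lemma co_normN n (G A : 'M[R]_n) : co_norm G (- A) = co_norm G A.
Proof. by rewrite -scaleN1r co_normZ normrN1 mul1r. Qed.

Lemma co_normD n (G A B : 'M[R]_n) : posdef G ->
  co_norm G (A + B) <= co_norm G A + co_norm G B.
Proof.
move=> /posdef_cholesky[P [_ uP ->]].
rewrite (congr_unit_surj A uP) (congr_unit_surj B uP).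
move: (invmx P *m A *m _) (invmx P *m B *m _) => {}A {}B.
rewrite -mulmxDl -mulmxDr !co_norm_cholesky//.
rewrite -[leRHS]ger0_norm ?addr_ge0 ?sqrtr_ge0// -sqrtr_sqr ler_wsqrtr//.
rewrite sqrrD !sqr_sqrtr ?mxdot_ge0//.
rewrite mxdotDl ![mxdot _ (_ + _)]mxdotC !mxdotDl [mxdot B A]mxdotC.
suff : mxdot A B <= Num.sqrt (mxdot A A) * Num.sqrt (mxdot B B) by nra.
rewrite -sqrtrM ?mxdot_ge0// (le_trans (ler_norm _))// -sqrtr_sqr.
by rewrite ler_wsqrtr// mxdot_CauchySchwarz.
Qed.

Lemma co_norm_sum n (G : 'M[R]_n) k (A : 'I_k -> 'M[R]_n) : posdef G ->
  co_norm G (\sum_i A i) <= \sum_i co_norm G (A i).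
Proof.
move=> pG; elim/big_ind2 : _ => //; first by rewrite co_norm0.
by move=> x B y C xB yC; rewrite (le_trans (co_normD _ _ pG))// lerD.
Qed.

Lemma co_norm_eq0 n (G A : 'M[R]_n) : posdef G -> co_norm G A = 0 -> A = 0.
Proof.
move=> /posdef_cholesky[P [_ uP ->]]; rewrite (congr_unit_surj A uP).
move: (invmx P *m A *m _) => {}A; rewrite co_norm_cholesky// => /eqP.
rewrite sqrtr_eq0 => A0; have /mxdot_eq0-> : mxdot A A = 0.
  by apply/eqP; rewrite eq_le A0 mxdot_ge0.
by rewrite mulmx0 mul0mx.
Qed.

Lemma co_norm_self n (G : 'M[R]_n) : posdef G -> co_norm G G = Num.sqrt n%:R.
Proof.
move=> pG; have uG := posdef_unit pG; have [sG _] := pG.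
by rewrite /co_norm mulVmx// mul1mx sG mulVmx// mxtrace1.
Qed.

(** A tensor acts on vectors with at most its norm; hence the norm controls
    each component. *)
Lemma bilinear_le_co_norm n (G A : 'M[R]_n) (v w : 'rV[R]_n) : posdef G ->
  ((v *m A *m w^T) 0 0) ^+ 2 <= co_norm G A ^+ 2 * (qform G v * qform G w).
Proof.
move=> /posdef_cholesky[P [_ uP ->]]; rewrite (congr_unit_surj A uP).
move: (invmx P *m A *m _) => {}A; rewrite co_norm_cholesky//.
rewrite sqr_sqrtr ?mxdot_ge0//.
have qP z : qform (P *m P^T) z = qform 1%:M (z *m P).
  by rewrite -qform_congr mulmx1.
rewrite !qP.
have -> : v *m (P *m A *m P^T) *m w^T = (v *m P) *m A *m (w *m P)^T.
  by rewrite trmx_mul !mulmxA.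
move: (v *m P) (w *m P) => {}v {}w.
have -> : (v *m A *m w^T) 0 0 = mxdot A (v^T *m w).
  rewrite /mxdot trmx_mul trmxK mulmxA mxtrace_mulC mulmxA /mxtrace.
  by rewrite big_ord1.
have -> : qform 1%:M v * qform 1%:M w = mxdot (v^T *m w) (v^T *m w).
  rewrite /mxdot trmx_mul trmxK -mulmxA mxtrace_mulC !mulmxA.
  by rewrite -[_ *m v *m v^T]mulmxA /mxtrace big_ord1 mxE big_ord1 mulrC /qform !mulmx1.
exact: mxdot_CauchySchwarz.
Qed.

Lemma qform_le_co_norm n (G A : 'M[R]_n) v : posdef G ->
  `|qform A v| <= co_norm G A * qform G v.
Proof.
move=> pG; have := bilinear_le_co_norm A v v pG.
rewrite -/(qform A v) -expr2 -exprMn -[X in X <= _]real_normK ?num_real//.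
by rewrite ler_sqr// nnegrE// mulr_ge0 ?co_norm_ge0 ?posdef_qform_ge0.
Qed.

Lemma entry_le_co_norm n (G A : 'M[R]_n) i j : posdef G ->
  `|A i j| <= Num.sqrt (G i i * G j j) * co_norm G A.
Proof.
move=> pG; have := bilinear_le_co_norm A (delta_mx 0 i) (delta_mx 0 j) pG.
rewrite !qform_delta -rowE.
have -> : (row i A *m (delta_mx (0 : 'I_1) j)^T) 0 0 = A i j.
  rewrite mxE (bigD1 j)//= !mxE !eqxx mulr1 big1 ?addr0// => k kj.
  by rewrite !mxE (negbTE kj) mulr0.
move=> h; rewrite -sqrtr_sqr -[co_norm _ _]ger0_norm ?co_norm_ge0// -sqrtr_sqr.
have Gge0 k : 0 <= G k k by rewrite -qform_delta posdef_qform_ge0.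
by rewrite -sqrtrM ?mulr_ge0// ler_wsqrtr// mulrC.
Qed.

(** * Comparison of two inner products *)

Definition loewner_le {n} (A B : 'M[R]_n) := forall v, qform A v <= qform B v.

Lemma mxtrace_loewner_le n (X X' Y D : 'M[R]_n) : posdef Y ->
  loewner_le X X' -> \tr (X *m D *m Y *m D^T) <= \tr (X' *m D *m Y *m D^T).
Proof.
move=> /posdef_cholesky[Q [_ _ ->]] XX'.
have E Z : \tr (Z *m D *m (Q *m Q^T) *m D^T) =
    \sum_i qform Z (row i (D *m Q)^T).
  transitivity (\tr ((D *m Q)^T *m Z *m (D *m Q))).
    by rewrite -[in RHS]mulmxA [RHS]mxtrace_mulC trmx_mul !mulmxA.
  apply: eq_bigr => i _; rewrite /qform -row_mul [RHS]mxE [LHS]mxE.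
  by apply: eq_bigr => k _; rewrite !mxE; congr (_ * _); rewrite ?mxE.
by rewrite !E ler_sum.
Qed.

Lemma mxtrace_loewner_le2 n (X X' Y Y' D : 'M[R]_n) :
  posdef X -> posdef X' -> posdef Y -> loewner_le X X' -> loewner_le Y Y' ->
  \tr (X *m D *m Y *m D^T) <= \tr (X' *m D *m Y' *m D^T).
Proof.
move=> pX pX' pY XX' YY'; apply: (le_trans (mxtrace_loewner_le D pY XX')).
have E (Z : 'M[R]_n) : \tr (X' *m D *m Z *m D^T) = \tr (Z *m D^T *m X' *m (D^T)^T).
  by rewrite trmxK -(mulmxA (X' *m D)) mxtrace_mulC !mulmxA.
by rewrite !E mxtrace_loewner_le.
Qed.

Lemma mxtrace_scale2 n a b (X D Y E : 'M[R]_n) :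
  \tr ((a *: X) *m D *m (b *: Y) *m E) = a * b * \tr (X *m D *m Y *m E).
Proof. by rewrite -!scalemxAl -!scalemxAr -!scalemxAl !mxtraceZ mulrA. Qed.

Lemma posdefZ n c (G : 'M[R]_n) : 0 < c -> posdef G -> posdef (c *: G).
Proof.
move=> c0 [sG pG]; split; first by rewrite linearZ/= sG.
by move=> v v0; rewrite -/(qform (c *: G) v) qformZ pmulr_rgt0//; exact: pG.
Qed.

Lemma dot_qform_le n (G : 'M[R]_n) (v w : 'rV[R]_n) : posdef G ->
  ((v *m w^T) 0 0) ^+ 2 <= qform (invmx G) v * qform G w.
Proof.
move=> /posdef_cholesky[P [_ uP ->]].
have -> : qform (P *m P^T) w = mxdot (w *m P) (w *m P).
  by rewrite /mxdot /mxtrace big_ord1 /qform trmx_mul !mulmxA.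
rewrite invmx_mul ?unitmx_tr//.
have -> : qform (invmx P^T *m invmx P) v =
    mxdot (v *m invmx P^T) (v *m invmx P^T).
  by rewrite /mxdot /mxtrace big_ord1 /qform trmx_mul trmx_inv trmxK !mulmxA.
have -> : (v *m w^T) 0 0 = mxdot (v *m invmx P^T) (w *m P).
  rewrite /mxdot /mxtrace big_ord1 trmx_mul -!mulmxA [invmx _ *m _]mulmxA.
  by rewrite mulVmx ?unitmx_tr// mul1mx.
exact: mxdot_CauchySchwarz.
Qed.

(** Inversion reverses the Loewner order, since the inverse form is a Legendre
    transform. *)
Lemma loewner_le_inv n c (G H : 'M[R]_n) : posdef G -> posdef H -> 0 <= c ->
  loewner_le G (c *: H) -> loewner_le (invmx H) (c *: invmx G).
Proof.
move=> pG pH c0 GH v; rewrite qformZ.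
have := dot_qform_le v (v *m invmx H) pG.
have E : (v *m (v *m invmx H)^T) 0 0 = qform (invmx H) v.
  have [sH _] := posdef_inv pH.
  by rewrite trmx_mul sH mulmxA.
have E2 : qform H (v *m invmx H) = qform (invmx H) v.
  rewrite -E /qform -[v *m invmx H *m H]mulmxA mulVmx ?posdef_unit//.
  by rewrite mulmx1.
rewrite E => h.
have {}h : qform (invmx H) v ^+ 2 <= c * qform (invmx G) v * qform (invmx H) v.
  apply: (le_trans h); rewrite [c * _]mulrC -mulrA ler_wpM2l//.
    by rewrite posdef_qform_ge0//; exact: posdef_inv.
  by rewrite -E2 -qformZ.
have := posdef_qform_ge0 v (posdef_inv pH).
rewrite le_eqVlt => /predU1P[<-|q0].
  by rewrite mulr_ge0// posdef_qform_ge0//; exact: posdef_inv.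
by rewrite -(ler_pM2r q0) -expr2.
Qed.

Lemma co_norm_loewner_le n c (G H A : 'M[R]_n) : posdef G -> posdef H -> 0 < c ->
  loewner_le G (c *: H) -> co_norm H A <= c * co_norm G A.
Proof.
move=> pG pH c0 GH; have HG := loewner_le_inv pG pH (ltW c0) GH.
rewrite -[c in leRHS]ger0_norm ?(ltW c0)// -sqrtr_sqr -sqrtrM ?sqr_ge0//.
rewrite ler_wsqrtr//.
have -> : c ^+ 2 * \tr (invmx G *m A *m invmx G *m A^T) =
  \tr ((c *: invmx G) *m A *m (c *: invmx G) *m A^T).
  by rewrite mxtrace_scale2.
have pG' := posdefZ c0 (posdef_inv pG).
by apply: mxtrace_loewner_le2 => //; exact: posdef_inv.
Qed.

Lemma contra_norm_loewner_le n c (G H A : 'M[R]_n) :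
  posdef G -> posdef H -> 0 < c ->
  loewner_le G (c *: H) -> contra_norm G A <= c * contra_norm H A.
Proof.
move=> pG pH c0 GH; rewrite !contra_normE.
apply: co_norm_loewner_le => //; try exact: posdef_inv.
exact: (loewner_le_inv pG pH (ltW c0)).
Qed.

(** Write [A^-1 - B^-1 = A^-1 (B - A) B^-1] and absorb the outer factors by means
    of the lower bounds on [A] and [B].  This controls the inverse metrics without
    differentiating them in time. *)
Lemma contra_norm_inv_sub_le n c d (G A B : 'M[R]_n) :
  posdef G -> posdef A -> posdef B -> 0 < c -> 0 < d ->
  loewner_le G (c *: A) -> loewner_le G (d *: B) ->
  contra_norm G (invmx A - invmx B) <= c * d * co_norm G (A - B).
Proof.
move=> pG pA pB c0 d0 GA GB.
have [uA uB] := (posdef_unit pA, posdef_unit pB).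
have -> : invmx A - invmx B = invmx A *m (B - A) *m invmx B.
  by rewrite mulmxBr mulVmx// mulmxBl mul1mx -mulmxA mulmxV// mulmx1.
rewrite -(opprB B A) co_normN; set D := B - A.
have cd0 : 0 <= c * d by rewrite mulr_ge0 ?ltW.
rewrite -[c * d]ger0_norm// -sqrtr_sqr -sqrtrM ?sqr_ge0// ler_wsqrtr//.
have [[sA _] [sB _]] := (posdef_inv pA, posdef_inv pB).
have -> : \tr (G *m (invmx A *m D *m invmx B) *m G *m (invmx A *m D *m invmx B)^T)
  = \tr ((invmx A *m G *m (invmx A)^T) *m D *m (invmx B *m G *m (invmx B)^T) *m D^T).
  by rewrite !trmx_mul sA sB !mulmxA mxtrace_mulC !mulmxA.
have key (C : 'M[R]_n) e : posdef C -> 0 < e -> loewner_le G (e *: C) ->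
    loewner_le (invmx C *m G *m (invmx C)^T) (e ^+ 2 *: invmx G).
  move=> pC e0 GC v; rewrite qform_congr (le_trans (GC _))// !qformZ.
  have [sC _] := posdef_inv pC.
  rewrite -qform_congr mulVmx ?posdef_unit// mul1mx sC expr2 -mulrA.
  by rewrite ler_pM2l// -qformZ; exact: (loewner_le_inv pG pC (ltW e0)).
have pk (C : 'M[R]_n) : posdef C -> posdef (invmx C *m G *m (invmx C)^T).
  move=> pC; have [P [_ uP ->]] := posdef_cholesky pG.
  rewrite mulmxA -mulmxA -trmx_mul; apply: mul_tr_posdef.
  by rewrite unitmx_mul unitmx_inv posdef_unit.
have -> : (c * d) ^+ 2 * \tr (invmx G *m D *m invmx G *m D^T) =
  \tr ((c ^+ 2 *: invmx G) *m D *m (d ^+ 2 *: invmx G) *m D^T).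
  by rewrite mxtrace_scale2 exprMn.
apply: mxtrace_loewner_le2; try exact: key; try exact: pk.
by apply: posdefZ (posdef_inv pG); rewrite exprn_gt0.
Qed.

(** In a Cholesky basis of [H] the form [G] has diagonal entries at most [c], and
    these bound the squared diagonal of its own Cholesky factor. *)
Lemma det_loewner_le n c (G H : 'M[R]_n) : posdef G -> posdef H -> 0 <= c ->
  loewner_le G (c *: H) -> \det G <= c ^+ n * \det H.
Proof.
move=> pG /posdef_cholesky[P [_ uP ->]] c0 GH.
pose B := invmx P *m G *m (invmx P)^T.
have GE : G = P *m B *m P^T.
  by rewrite /B trmx_inv -congr_unit_surj.
have pB : posdef B.
  have [Q [_ uQ EQ]] := posdef_cholesky pG.
  rewrite /B EQ mulmxA -mulmxA -trmx_mul; apply: mul_tr_posdef.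
  by rewrite unitmx_mul unitmx_inv uP.
have Bc i : B i i <= c.
  rewrite -qform_delta /B qform_congr (le_trans (GH _))// qformZ.
  have -> : P *m P^T = P *m 1%:M *m P^T by rewrite mulmx1.
  rewrite qform_congr mulmxKV// qform_delta mxE eqxx mulr1//.
clearbody B; rewrite GE !det_mulmx !det_tr mulrAC [leRHS]mulrC.
rewrite ler_wpM2l -?expr2 ?sqr_ge0//.
have [L [tL _ BL]] := posdef_cholesky pB.
rewrite BL det_mulmx det_tr det_trig// -expr2 -prodrXl.
rewrite -[n in leRHS]card_ord -prodr_const ler_prod// => i _.
rewrite sqr_ge0/= (le_trans _ (Bc i))// BL mxE (bigD1 i)//= mxE -expr2.
by rewrite lerDl sumr_ge0// => j _; rewrite mxE -expr2 sqr_ge0.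
Qed.

End MatrixNorms.

(** * Real-variable lemmas *)

Section RealVariable.
Context {R : realType}.

Lemma powR_weighted_monotone (q dq : R -> R) (r t k : R) :
  0 < r -> r <= t ->
  (forall s, r < s < t -> is_derive s 1 q (dq s)) ->
  {within `[r, t], continuous q} ->
  (forall s, r < s < t -> 0 <= k / s * q s + dq s) ->
  r `^ k * q r <= t `^ k * q t.
Proof.
move=> r0; rewrite le_eqVlt => /predU1P[->//|rt] dqE cq kq.
pose f s := s `^ k * q s.
pose df s := s `^ k * (k / s * q s + dq s).
have fd s : s \in `]r, t[%R -> is_derive s 1 f (df s).
  rewrite in_itv/= => rst; have s0 : 0 < s by case/andP: rst => /(lt_trans r0).
  apply: is_derive_eq (is_deriveM (is_derive1_powR k s0) (dqE _ rst)) _.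
  rewrite /df /GRing.scale/= powRB; last by rewrite (gt_eqF s0) implybT.
  by rewrite powRr1 ?ltW//; field; rewrite gt_eqF.
have cp : {within `[r, t], continuous (@powR R ^~ k)}.
  apply: derivable_within_continuous => s; rewrite in_itv/= => /andP[rs _].
  by apply: derivable_powR; rewrite in_itv/= (lt_le_trans r0 rs).
have cf : {within `[r, t], continuous f}.
  by move=> s; apply: (@continuousM R (subspace `[r, t]) (@powR R ^~ k) q s);
    [exact: cp|exact: cq].
have [c cI fE] := MVT rt fd cf.
rewrite -subr_ge0 -/(f r) -/(f t) fE mulr_ge0 ?subr_ge0 ?(ltW rt)//.
rewrite /df mulr_ge0 ?powR_ge0 ?kq//.
Qed.

(** Gronwall's inequality for a logarithmic derivative of size [k / s]. *)
Lemma gronwall_powR (q dq : R -> R) (r t k : R) :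
  0 < r -> r <= t ->
  (forall s, r < s < t -> is_derive s 1 q (dq s)) ->
  {within `[r, t], continuous q} ->
  (forall s, r < s < t -> `|dq s| <= k / s * q s) ->
  q r <= (t / r) `^ k * q t /\ q t <= (t / r) `^ k * q r.
Proof.
move=> r0 rt dqE cq kq; have t0 : 0 < t by exact: lt_le_trans rt.
have E : (t / r) `^ k = t `^ k / r `^ k.
  rewrite powRM ?invr_ge0 ?(ltW r0) ?(ltW t0)//; congr (_ * _).
  by rewrite -powR_inv1 ?(ltW r0)// -powRrM mulN1r powRN.
split.
  have := @powR_weighted_monotone q dq r t k r0 rt dqE cq.
  rewrite E mulrAC ler_pdivlMr ?powR_gt0// [q r * _]mulrC; apply.
  by move=> s /kq; rewrite ler_norml -[- _ <= _]subr_ge0 opprK addrC => /andP[].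
have := @powR_weighted_monotone (- q) (- dq) r t (- k) r0 rt.
move=> H; suff : r `^ (- k) * (- q) r <= t `^ (- k) * (- q) t.
  rewrite !powRN !fctE !mulrN lerN2 ler_pdivrMl ?powR_gt0// E mulrCA !mulrA.
  by rewrite [t `^ k / _]mulrC.
apply: H.
- by move=> s /dqE h; apply: is_deriveN.
- by move=> s; apply: (@continuousN R R (subspace `[r, t]) q s); exact: cq.
- by move=> s /kq; rewrite ler_norml -[_ <= k / s * q s]subr_ge0 => /andP[_];
  congr (0 <= _); rewrite !fctE; ring.
Qed.

(** By the mean value theorem on each piece and the uniform continuity of [dw]. *)
Lemma cvg_riemann_sum (w dw : R -> R) (a b : R) : a < b ->
  (forall s, a < s < b -> is_derive s 1 w (dw s)) ->
  {within `[a, b], continuous w} -> {within `[a, b], continuous dw} ->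
  (\sum_(i < m.+1) ((b - a) / m.+1%:R) * dw (a + (b - a) / m.+1%:R * i%:R))
     @[m --> \oo] --> w b - w a.
Proof.
move=> ab wd cw cdw; apply/cvgrPdist_le => e e0.
have ba : 0 < b - a by rewrite subr_gt0.
pose e' := e / (b - a).
have e'0 : 0 < e' by rewrite divr_gt0.
have [d d0 Hd] : exists2 d : R, 0 < d & forall x y, x \in `[a, b] ->
    y \in `[a, b] -> `|y - x| < d -> `|dw y - dw x| <= e'.
  have : \forall d \near (0 : R)^'+, `[a, b]%classic `<=` [set x |
      x \in `[a, b] -> forall y, y \in `[a, b] -> `|y - x| < d ->
      `|dw y - dw x| <= e'].
    apply: ((compact_near_coveringP _).1 (@segment_compact R a b) R) => x xab.
    have /cvgrPdist_lt/(_ (e' / 2)) : dw @ within `[a, b] (nbhs x) --> dw x.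
      by move: cdw => /subspace_continuousP; apply.
    rewrite divr_gt0// => /(_ isT); rewrite near_withinE => -[d /= d0 Hd].
    exists (ball x (d / 2), [set z | z < d / 2]) => /=.
      split; first by apply: nbhsx_ballx; rewrite divr_gt0.
      by apply: nbhs_right_lt; rewrite divr_gt0.
    case=> x' d' [/= xx' d'd] x'ab y yab yx'.
    have yd : `|x - y| < d.
      rewrite -(subrK x' x) -addrA (le_lt_trans (ler_normD _ _))//.
      by rewrite [d]splitr ltrD// distrC (lt_trans yx').
    have x'd : `|x - x'| < d.
      by rewrite (lt_trans xx')// ltr_pdivrMr// mulr_natr mulr2n ltrDl.
    have yl := Hd _ yd yab; have x'l := Hd _ x'd x'ab.
    rewrite -(subrK (dw x) (dw y)) -addrA (le_trans (ler_normD _ _))//.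
    by rewrite [e']splitr distrC lerD// ltW.
  move=> U; near (0 : R)^'+ => d; exists d => [|x y xab].
    by near: d; exact: nbhs_right_gt.
  by move: x xab y; near: d; apply: filterS U => d H x xab y; exact: H.
pose h m : R := (b - a) / m.+1%:R.
pose tau m i : R := a + h m * i%:R.
have h0 m : 0 < h m by rewrite divr_gt0.
have tau_last m : tau m m.+1 = b by rewrite /tau /h divfK// addrC subrK.
have tau_mono m i j : (i <= j)%N -> tau m i <= tau m j.
  by move=> ij; rewrite lerD2l ler_wpM2l ?(ltW (h0 _))// ler_nat.
have tau_itv m i : (i <= m.+1)%N -> a <= tau m i <= b.
  move=> im; rewrite -[X in X <= _ <= _](_ : tau m 0 = a) ?tau_mono//.
    by rewrite -(tau_last m) tau_mono.
  by rewrite /tau mulr0 addr0.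
near=> m.
have hd : h m < d.
  rewrite /h mulrC -ltr_pdivlMr//; near: m.
  exact: (near_infty_natSinv_lt (PosNum (divr_gt0 d0 ba))).
have -> : w b - w a = \sum_(i < m.+1) (w (tau m i.+1) - w (tau m i)).
  rewrite -(big_mkord xpredT (fun i => w (tau m i.+1) - w (tau m i))).
  by rewrite telescope_sumr// tau_last /tau mulr0 addr0.
rewrite -sumrB (le_trans (ler_norm_sum _ _ _))//.
have -> : e = \sum_(i < m.+1) h m * e'.
  by rewrite sumr_const card_ord -mulrnAl /h -mulr_natr divfK// /e' mulrC divfK ?gt_eqF.
apply: ler_sum => i _.
have /andP[ai ib] := tau_itv m i (ltnW (ltn_ord i)).
have /andP[ai1 i1b] := tau_itv m i.+1 (ltn_ord i).
have tS : tau m i.+1 - tau m i = h m.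
  by rewrite /tau -addn1 natrD; ring.
have tlt : tau m i < tau m i.+1 by rewrite -subr_gt0 tS.
have [||c cI ->] := @MVT R w dw _ _ tlt.
- move=> s; rewrite in_itv/= => /andP[ais sib]; apply: wd.
  by rewrite (le_lt_trans ai ais) (lt_le_trans sib i1b).
- by apply: continuous_subspaceW cw; apply: subset_itv; rewrite bnd_simp.
move: cI; rewrite in_itv/= => /andP[ic ci].
rewrite tS mulrC -mulrBr normrM (ger0_norm (ltW (h0 m))) ler_wpM2l ?(ltW (h0 m))//.
apply: Hd; rewrite ?in_itv/= ?ai// ?(le_trans ai (ltW ic)) ?(le_trans (ltW ci))//.
rewrite ger0_norm ?subr_ge0 ?(ltW ic)// (lt_trans _ hd)//.
by rewrite -tS ltrD2r.
Unshelve. all: by end_near. Qed.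

End RealVariable.

(** * Integrals and p-norms *)

Section NonmeasurableIntegrals.
Context d (T : measurableType d) (R : realType).
Implicit Types (mu nu : {measure set T -> \bar R}).
Local Open Scope ereal_scope.

Import HBNNSimple.

(** The integral of a nonnegative function is a supremum over the simple functions
    below it, and these can be rescaled one by one.  The functions are arbitrary,
    so that iterated integrals can be compared. *)
Lemma ge0_le_integral_scale mu nu (c k : R) (f g : T -> \bar R) :
  (0 <= c)%R -> (0 < k)%R ->
  (forall A, measurable A -> mu A <= c%:E * nu A) ->
  (forall x, 0 <= f x) -> (forall x, 0 <= g x) ->
  (forall x, f x <= k%:E * g x) ->
  \int[mu]_x f x <= (c * k)%:E * \int[nu]_x g x.
Proof.
move=> c0 k0 munu f0 g0 fg; rewrite !ge0_integralTE//.
apply: ge_ereal_sup => _ [h /= hf <-].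
have ki0 : (0 <= k^-1)%R by rewrite invr_ge0 ltW.
pose h' := scale_nnsfun h ki0.
have h'g x : (h' x)%:E <= g x.
  rewrite /h'/= EFinM lee_pdivrMl// (le_trans (hf x))//; exact: fg.
have -> : sintegral mu h = k%:E * sintegral mu h'.
  rewrite -sintegralrM; apply: eq_sintegral => x /=.
  by rewrite mulVKf ?gt_eqF.
rewrite [(c * k)%R]mulrC EFinM -muleA lee_pmul2l ?lte_fin//.
apply: (@le_trans _ _ (c%:E * sintegral nu h')).
  rewrite !sintegralE ge0_mule_fsumr; last by move=> r; exact: nnsfun_mulemu_ge0.
  apply: lee_fsum => // r [t _ <-].
  rewrite muleCA lee_pmul ?lee_fin//; exact: munu.
apply: lee_wpmul2l; first by rewrite lee_fin.
by apply: ereal_sup_ubound; exists h'.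
Qed.

Lemma ge0_le_integral_nonmeasurable mu (f g : T -> \bar R) :
  (forall x, 0 <= f x) -> (forall x, f x <= g x) ->
  \int[mu]_x f x <= \int[mu]_x g x.
Proof.
move=> f0 fg; have := @ge0_le_integral_scale mu mu 1 1 f g ler01 ltr01.
rewrite mulr1 mul1e; apply => //.
- by move=> A _; rewrite mul1e.
- by move=> x; rewrite (le_trans (f0 x)).
- by move=> x; rewrite mul1e.
Qed.

End NonmeasurableIntegrals.

Section PNorms.
Context d (T : measurableType d) (R : realType).
Implicit Types (mu nu : {measure set T -> \bar R}).
Local Open Scope ereal_scope.

Lemma lee_poweR (x y : \bar R) (r : R) : (0 <= r)%R -> 0 <= x -> x <= y ->
  x `^ r <= y `^ r.
Proof.
move=> r0 x0 xy; apply: gt0_ler_poweR => //; rewrite in_itv/= leey andbT//.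
exact: le_trans xy.
Qed.

Lemma Lnorm_EFinE mu (p : R) (f : T -> R) :
  'N[mu]_p%:E[EFin \o f] = (\int[mu]_x (`|f x| `^ p)%:E) `^ p^-1.
Proof. by rewrite unlock. Qed.

Lemma Lnorm_le_powR mu (p K : R) (f : T -> R) : (0 < p)%R -> (0 <= K)%R ->
  ('N[mu]_p%:E[EFin \o f] <= K%:E) =
  (\int[mu]_x (`|f x| `^ p)%:E <= (K `^ p)%:E).
Proof.
move=> p0 K0; apply/idP/idP => H.
  have -> : \int[mu]_x (`|f x| `^ p)%:E = 'N[mu]_p%:E[EFin \o f] `^ p.
    by rewrite powR_Lnorm ?gt_eqF.
  by rewrite -poweR_EFin lee_poweR ?Lnorm_ge0// ltW.
rewrite Lnorm_EFinE; have -> : K%:E = (K `^ p)%:E `^ p^-1 :> \bar R.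
  by rewrite poweR_EFin -powRrM divff ?gt_eqF// powRr1.
rewrite lee_poweR ?invr_ge0 ?(ltW p0)//.
by apply: integral_ge0 => x _; rewrite lee_fin powR_ge0.
Qed.

Lemma Lnorm_le_scale mu nu (p c k : R) (f g : T -> R) :
  (0 < p)%R -> (0 <= c)%R -> (0 < k)%R ->
  (forall A, measurable A -> mu A <= c%:E * nu A) ->
  (forall x, 0 <= f x <= k * g x)%R ->
  'N[mu]_p%:E[EFin \o f] <= ((c * k `^ p) `^ p^-1)%:E * 'N[nu]_p%:E[EFin \o g].
Proof.
move=> p0 c0 k0 munu fg; rewrite !Lnorm_EFinE -poweR_EFin -poweRM; last 2 first.
- by rewrite lee_fin mulr_ge0// powR_ge0.
- by apply: integral_ge0 => x _; rewrite lee_fin powR_ge0.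
have ck0 : 0 <= (c * k `^ p)%:E by rewrite lee_fin mulr_ge0// powR_ge0.
have i0 (m : {measure set T -> \bar R}) (h : T -> R) : 0 <= \int[m]_x (`|h x| `^ p)%:E.
  by apply: integral_ge0 => x _; rewrite lee_fin powR_ge0.
rewrite lee_poweR ?invr_ge0 ?(ltW p0)//.
apply: ge0_le_integral_scale => //; rewrite ?powR_gt0// => x.
have /andP[f0 fgx] := fg x.
have g0 : (0 <= g x)%R by rewrite -(pmulr_rge0 _ k0) (le_trans f0).
rewrite -EFinM lee_fin !ger0_norm// -powRM ?(ltW k0)//.
by rewrite ge0_ler_powR ?(ltW p0)// nnegrE ?mulr_ge0 ?(ltW k0).
Qed.

Lemma Lnorm_le_mul mu (p k : R) (f g : T -> R) : (0 < p)%R -> (0 < k)%R ->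
  (forall x, 0 <= f x <= k * g x)%R ->
  'N[mu]_p%:E[EFin \o f] <= k%:E * 'N[mu]_p%:E[EFin \o g].
Proof.
move=> p0 k0 fg; have := @Lnorm_le_scale mu mu p 1 k f g p0 ler01 k0.
rewrite mul1r -powRrM divff ?gt_eqF// powRr1 ?(ltW k0)//; apply => // A _.
by rewrite mul1e.
Qed.

Lemma Lnorm_sum_le mu (p K : R) (f : nat -> T -> R) m :
  (1 <= p)%R -> (0 <= K)%R -> (forall i, measurable_fun setT (f i)) ->
  (forall i, (i < m)%N -> 'N[mu]_p%:E[EFin \o f i] <= K%:E) ->
  'N[mu]_p%:E[EFin \o (fun x => \sum_(i < m) f i x)%R] <= (m%:R * K)%:E.
Proof.
move=> p1 K0 mf; have p0 := lt_le_trans ltr01 p1; elim: m => [|m IH] fK.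
  rewrite mul0r Lnorm_le_powR// powR0 ?gt_eqF//.
  under eq_integral do rewrite big_ord0 normr0 powR0 ?gt_eqF//.
  by rewrite integral0.
have -> : (fun x => \sum_(i < m.+1) f i x)%R =
    ((fun x => \sum_(i < m) f i x) \+ f m)%R.
  by apply/funext => x; rewrite big_ord_recr.
apply: (le_trans (minkowski_EFin _ _ _ _)) => //.
  exact: measurable_sum.
rewrite -natr1 mulrDl mul1r EFinD leeD ?fK//.
by apply: IH => i im; rewrite fK// ltnW.
Qed.

Lemma Lnorm_fatou mu (p K : R) (h : nat -> T -> R) (g : T -> R) :
  (0 < p)%R -> (0 <= K)%R -> (forall m, measurable_fun setT (h m)) ->
  (forall x, h ^~ x @ \oo --> g x) ->
  (forall m, 'N[mu]_p%:E[EFin \o h m] <= K%:E) ->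
  'N[mu]_p%:E[EFin \o g] <= K%:E.
Proof.
move=> p0 K0 mh hg hK; rewrite Lnorm_le_powR//.
pose F (m : nat) (x : T) : \bar R := (`|h m x| `^ p)%:E.
have mF m : measurable_fun setT (F m).
  apply/measurable_EFinP; apply: (measurableT_comp (measurable_powR _)).
  exact: measurableT_comp.
have Fl x : F ^~ x @ \oo --> (`|g x| `^ p)%:E.
  apply: cvg_EFin; first exact: nearW.
  have : (fun m => `|h m x|%R) @ \oo --> (`|g x|)%R by apply: cvg_norm; exact: hg.
  move=> hgx; rewrite [X in X @ _](_ : _ = (@powR R ^~ p) \o (fun m => `|h m x|%R))//.
  have [g0|g0] := eqVneq (g x) 0%R; last first.
    apply: continuous_cvg hgx; apply: differentiable_continuous.
    by apply/derivable1_diffP/derivable_powR; rewrite in_itv/= normr_gt0 g0.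
  rewrite g0 normr0 powR0 ?gt_eqF//; rewrite g0 normr0 in hgx.
  apply/cvgrPdist_le => e e0; move/cvgrPdist_le : hgx.
  move=> /(_ _ (powR_gt0 p^-1 e0)); apply: filterS => m /=.
  rewrite !sub0r !normrN normr_id => he.
  rewrite ger0_norm ?powR_ge0//.
  have -> : e = ((e `^ p^-1) `^ p)%R.
    by rewrite -powRrM mulVf ?gt_eqF// powRr1// ltW.
  by rewrite ge0_ler_powR ?(ltW p0)// nnegrE// powR_ge0.
have -> : \int[mu]_x (`|g x| `^ p)%:E = \int[mu]_x limn_einf (F ^~ x).
  by apply: eq_integral => x _; rewrite (cvg_limn_einf_sup (Fl x)).
apply: (le_trans (@fatou _ _ _ mu _ measurableT F mF _)).
  by move=> n x _; rewrite lee_fin powR_ge0.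
rewrite limn_einf_lim; apply: lime_le; first exact: is_cvg_einfs.
apply: nearW => m; apply: ereal_inf_le.
exists (\int[mu]_x F m x); first by exists m => /=.
by rewrite -Lnorm_le_powR.
Qed.

Lemma Lnorm_cvg0 mu (p : R) (f : R -> T -> R) (F : set_system R) {FF : Filter F} :
  (forall e : R, (0 < e)%R -> \forall s \near F, 'N[mu]_p%:E[EFin \o f s] <= e%:E) ->
  'N[mu]_p%:E[EFin \o f s] @[s --> F] --> 0.
Proof.
move=> H; apply/fine_cvgP; split.
  apply: filterS (H 1%R ltr01) => s hs; rewrite ge0_fin_numE ?Lnorm_ge0//.
  by rewrite (le_lt_trans hs) ?ltry.
apply/cvgrPdist_le => e e0; apply: filterS (H e e0) => s hs /=.
rewrite sub0r normrN ger0_norm ?fine_ge0 ?Lnorm_ge0//.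
have fin : 'N[mu]_p%:E[EFin \o f s] \is a fin_num.
  by rewrite ge0_fin_numE ?Lnorm_ge0// (le_lt_trans hs) ?ltry.
by rewrite -lee_fin fineK.
Qed.

End PNorms.

Section SeriesMajorant.
Context d (T : measurableType d) (R : realType).
Implicit Types (mu : {measure set T -> \bar R}).

Lemma geometric_sum_le (z : R) m : 0 <= z < 1 ->
  \sum_(i < m) z ^+ i <= (1 - z)^-1.
Proof.
move=> /andP[z0 z1]; rewrite -[leRHS]mul1r ler_pdivlMr ?subr_gt0// mulrC.
rewrite -opprB mulNr -subrX1 opprB gerBl exprn_ge0//.
Qed.

Lemma Lnorm_ae_le mu (p : R) (f g : T -> R) : 0 < p ->
  measurable_fun setT f -> measurable_fun setT g ->
  {ae mu, forall x, 0 <= f x <= g x} ->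
  ('N[mu]_p%:E[EFin \o f] <= 'N[mu]_p%:E[EFin \o g])%E.
Proof.
move=> p0 mf mg fg; rewrite !Lnorm_EFinE lee_poweR ?invr_ge0 ?(ltW p0)//.
  by apply: integral_ge0 => x _; rewrite lee_fin powR_ge0.
have mh (h : T -> R) : measurable_fun setT h ->
    measurable_fun setT (fun x => (`|h x| `^ p)%:E).
  move=> mh; apply/measurable_EFinP; apply: (measurableT_comp (measurable_powR _)).
  exact: measurableT_comp.
apply: ae_ge0_le_integral => //; try exact: mh.
apply: filterS fg => x /andP[f0 fgx] _; rewrite lee_fin !ger0_norm ?(le_trans f0)//.
by rewrite ge0_ler_powR ?(ltW p0)// nnegrE ?(le_trans f0).
Qed.

(** The decay [z ^+ (2 j)] is split in two: one half makes the sum of the p-th powers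
    of the [z ^- j * D j] integrable, the other bounds the sum of the [D j] by a
    geometric series times the largest of these weighted terms. *)
Lemma Lnorm_series_majorant mu (p kappa z : R) (D : nat -> T -> R) :
  1 <= p -> 0 <= kappa -> 0 < z < 1 ->
  (forall j, measurable_fun setT (D j)) -> (forall j x, 0 <= D j x) ->
  (forall j, 'N[mu]_p%:E[EFin \o D j] <= (kappa * z ^+ j.*2)%:E)%E ->
  exists (N : set T) (V : T -> R),
    [/\ measurable N /\ mu N = 0%E,
        measurable_fun setT V, (forall x, 0 <= V x),
        ('N[mu]_p%:E[EFin \o V] <= (kappa / (1 - z) ^+ 2)%:E)%E
      & forall x, ~ N x -> forall m, \sum_(j < m) D j x <= V x].
Proof.
move=> p1 k0 /andP[z0 z1] mD D0 DN; have p0 := lt_le_trans ltr01 p1.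
have z1' : 0 < 1 - z by rewrite subr_gt0.
pose F (j : nat) (x : T) : \bar R := ((z ^- j * D j x) `^ p)%:E.
have mF j : measurable_fun setT (F j).
  apply/measurable_EFinP; apply: (measurableT_comp (measurable_powR _)).
  by apply: measurable_funM => //; exact: measurable_cst.
have F0 j x : (0 <= F j x)%E by rewrite lee_fin powR_ge0.
pose W (x : T) : \bar R := (\sum_(j <oo) F j x)%E.
have mW : measurable_fun setT W by apply: ge0_emeasurable_sum.
have W0 x : (0 <= W x)%E by apply: nneseries_ge0.
have FI j : (\int[mu]_x F j x <= ((kappa * z ^+ j) `^ p)%:E)%E.
  have zj : 0 < z ^- j by rewrite invr_gt0 exprn_gt0.
  have -> : (\int[mu]_x F j x = \int[mu]_x (`|z ^- j * D j x| `^ p)%:E)%E.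
    by apply: eq_integral => x _; rewrite ger0_norm// mulr_ge0// ltW.
  rewrite -Lnorm_le_powR//; last by rewrite mulr_ge0// exprn_ge0// ltW.
  apply: (@le_trans _ _ ((z ^- j)%:E * 'N[mu]_p%:E[EFin \o D j])%E).
    by apply: Lnorm_le_mul => // x; rewrite lexx andbT mulr_ge0// ltW.
  apply: le_trans (lee_wpmul2l _ (DN j)) _; first by rewrite lee_fin ltW.
  by rewrite -EFinM lee_fin -addnn exprD mulrCA mulKf// gt_eqF// exprn_gt0.
have WI : (\int[mu]_x W x <= (kappa `^ p / (1 - z))%:E)%E.
  rewrite integral_nneseries//; apply: lime_le.
    by apply: is_cvg_nneseries => j _ _; exact: integral_ge0.
  apply: nearW => m.
  apply: (@le_trans _ _ (\sum_(0 <= j < m) (kappa `^ p * z ^+ j)%:E)%E).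
    apply: lee_sum => j _; apply: (le_trans (FI j)); rewrite lee_fin.
    rewrite powRM ?exprn_ge0 ?(ltW z0)// ler_wpM2l ?powR_ge0//.
    by rewrite ge1r_powR// exprn_gt0//= exprn_ile1// ltW.
  rewrite sumEFin lee_fin -mulr_sumr ler_wpM2l ?powR_ge0// big_mkord.
  by apply: geometric_sum_le; rewrite (ltW z0).
have Wint : mu.-integrable setT W.
  apply/integrableP; split => //.
  under eq_integral do rewrite gee0_abs//.
  by rewrite (le_lt_trans WI) ?ltry.
have [N [mN N0 WN]] := integrable_ae measurableT Wint.
pose V x := fine (W x) `^ p^-1 / (1 - z).
exists N, V; split => //.
- apply: measurable_funM; last exact: measurable_cst.
  apply: (measurableT_comp (measurable_powR _)).
  exact: measurableT_comp.
- by move=> x; rewrite mulr_ge0 ?powR_ge0// invr_ge0 ltW.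
- pose u := (1 - z)^-1.
  have u0 : 0 <= u by rewrite invr_ge0 ltW.
  have u1 : 1 <= u by rewrite invf_ge1// gerBl ltW.
  have -> : kappa / (1 - z) ^+ 2 = kappa * (u * u) by rewrite -invfM -expr2.
  rewrite Lnorm_le_powR ?mulr_ge0//.
  have u0' : 0 < u `^ p by rewrite powR_gt0// (lt_le_trans ltr01).
  apply: (@le_trans _ _ ((1 * u `^ p)%:E * \int[mu]_x W x)%E).
    apply: ge0_le_integral_scale => //.
    - by move=> A _; rewrite mul1e.
    - move=> x; have fW : 0 <= fine (W x) by rewrite fine_ge0.
      rewrite ger0_norm; last by rewrite mulr_ge0 ?powR_ge0.
      rewrite powRM ?powR_ge0// -powRrM mulVf ?gt_eqF// powRr1// mulrC EFinM.
      rewrite lee_pmul2l ?lte_fin//.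
      by have := W0 x; case: (W x) => //= r _; rewrite leey.
  rewrite mul1r; apply: le_trans (lee_wpmul2l _ WI) _; first by rewrite lee_fin ltW.
  rewrite -EFinM lee_fin !powRM ?mulr_ge0// mulrCA ler_wpM2l ?powR_ge0//.
  by rewrite ler_wpM2l ?powR_ge0// le1r_powR.
- move=> x Nx m.
  have Wfin : W x \is a fin_num.
    by apply: contrapT => h; apply: Nx; apply: WN => /= /(_ I).
  have DW j : D j x <= fine (W x) `^ p^-1 * z ^+ j.
    have FW : (F j x <= W x)%E.
      apply: le_trans (nneseries_lim_ge j.+1 _); last by [].
      by rewrite big_nat_recr//= leeDr// sume_ge0.
    rewrite -ler_pdivrMr ?exprn_gt0// mulrC.
    have zD : 0 <= z ^- j * D j x by rewrite mulr_ge0// invr_ge0 exprn_ge0 ?ltW.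
    rewrite -[leLHS]powRr1// -(@divff _ p) ?gt_eqF// powRrM.
    rewrite ge0_ler_powR ?invr_ge0 ?(ltW p0) ?nnegrE ?powR_ge0 ?fine_ge0//.
    by rewrite -lee_fin fineK.
  apply: (@le_trans _ _ (\sum_(j < m) fine (W x) `^ p^-1 * z ^+ j)).
    exact: ler_sum.
  rewrite -mulr_sumr ler_wpM2l ?powR_ge0//.
  by apply: geometric_sum_le; rewrite (ltW z0).
Qed.

End SeriesMajorant.

(** * Measurability and volume on a manifold *)

Section LebesgueInt.
Context {R : realType}.
Local Open Scope ereal_scope.

Lemma lebesgue_int_ge0 n (f : 'rV[R]_n -> \bar R) :
  (forall y, 0 <= f y) -> 0 <= lebesgue_int f.
Proof.
elim: n f => [|n IH] f f0 /=; first exact: f0.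
by apply: integral_ge0 => x _; exact: IH.
Qed.

Lemma lebesgue_int_le_scale n (k : R) (f g : 'rV[R]_n -> \bar R) : (0 < k)%R ->
  (forall y, 0 <= f y) -> (forall y, 0 <= g y) ->
  (forall y, f y <= k%:E * g y) -> lebesgue_int f <= k%:E * lebesgue_int g.
Proof.
move=> k0; elim: n f g => [|n IH] f g f0 g0 fg /=; first exact: fg.
rewrite -[k in k%:E]mul1r; apply: ge0_le_integral_scale => //.
- by move=> A _; rewrite mul1e.
- by move=> x; exact: lebesgue_int_ge0.
- by move=> x; exact: lebesgue_int_ge0.
- by move=> x; exact: IH.
Qed.

End LebesgueInt.

Section MeasurableMatrices.
Context d (T : measurableType d) (R : realType) (D : set T).

Definition measurable_mx m n (F : T -> 'M[R]_(m, n)) :=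
  forall a b, measurable_fun D (fun x => F x a b).

Lemma measurable_mxM m n p (F : T -> 'M[R]_(m, n)) (G : T -> 'M[R]_(n, p)) :
  measurable_mx F -> measurable_mx G -> measurable_mx (fun x => F x *m G x).
Proof.
move=> mF mG a b.
apply: (eq_measurable_fun (fun x => \sum_j F x a j * G x j b)).
  by move=> x _; rewrite mxE.
by apply: measurable_sum => j; exact: measurable_funM.
Qed.

Lemma measurable_mxT m n (F : T -> 'M[R]_(m, n)) :
  measurable_mx F -> measurable_mx (fun x => (F x)^T).
Proof.
move=> mF a b; apply: (eq_measurable_fun (fun x => F x b a)) => //.
by move=> x _; rewrite mxE.
Qed.

Lemma measurable_mxB m n (F G : T -> 'M[R]_(m, n)) :
  measurable_mx F -> measurable_mx G -> measurable_mx (fun x => F x - G x).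
Proof.
move=> mF mG a b; apply: (eq_measurable_fun (fun x => F x a b - G x a b)).
  by move=> x _; rewrite !mxE.
exact: measurable_funB.
Qed.

Lemma measurable_mxZ m n (c : T -> R) (F : T -> 'M[R]_(m, n)) :
  measurable_fun D c -> measurable_mx F -> measurable_mx (fun x => c x *: F x).
Proof.
move=> mc mF a b; apply: (eq_measurable_fun (fun x => c x * F x a b)).
  by move=> x _; rewrite mxE.
exact: measurable_funM.
Qed.

Lemma measurable_mx_sum m n (I : Type) (s : seq I) (F : I -> T -> 'M[R]_(m, n)) :
  (forall i, measurable_mx (F i)) -> measurable_mx (fun x => \sum_(i <- s) F i x).
Proof.
move=> mF a b; apply: (eq_measurable_fun (fun x => \sum_(i <- s) F i x a b)).
  by move=> x _; rewrite summxE.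
by apply: measurable_sum => i; exact: mF.
Qed.

Lemma measurable_mxtrace n (F : T -> 'M[R]_n) :
  measurable_mx F -> measurable_fun D (fun x => \tr (F x)).
Proof. by move=> mF; apply: measurable_sum => j. Qed.

Lemma measurable_det n (F : T -> 'M[R]_n) :
  measurable_mx F -> measurable_fun D (fun x => \det (F x)).
Proof.
move=> mF; apply: measurable_sum => s.
apply: measurable_funM; first exact: measurable_cst.
by apply: measurable_prod => i _; exact: mF.
Qed.

Lemma det_posdef_gt0 n (G : 'M[R]_n) : posdef G -> 0 < \det G.
Proof.
move=> /posdef_cholesky[P [_ uP ->]]; rewrite det_mulmx det_tr -expr2.
by rewrite exprn_even_gt0//= -unitfE -unitmxE.
Qed.

(** By Cramer's rule the entries are quotients of polynomials in those of [F]. *)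
Lemma measurable_invmx n (F : T -> 'M[R]_n) : (forall x, D x -> posdef (F x)) ->
  measurable_mx F -> measurable_mx (fun x => invmx (F x)).
Proof.
move=> pF mF a b.
apply: (eq_measurable_fun (fun x => \det (F x) `^ (-1) * cofactor (F x) b a)).
  move=> x /set_mem Dx; have pFx := pF x Dx.
  rewrite powR_inv1 ?(ltW (det_posdef_gt0 pFx))// /invmx posdef_unit//.
  by rewrite !mxE.
apply: measurable_funM.
  by apply: (measurableT_comp (measurable_powR _)); exact: measurable_det.
apply: measurable_funM; first exact: measurable_cst.
apply: measurable_det => i j.
by apply: (eq_measurable_fun (fun x => F x (lift b i) (lift a j))) => // x _; rewrite !mxE.
Qed.

Lemma measurable_co_norm n (G A : T -> 'M[R]_n) : (forall x, D x -> posdef (G x)) ->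
  measurable_mx G -> measurable_mx A ->
  measurable_fun D (fun x => co_norm (G x) (A x)).
Proof.
move=> pG mG mA; apply: measurableT_comp.
  by apply: continuous_measurable_fun; exact: sqrt_continuous.
apply: measurable_mxtrace; have mI := measurable_invmx pG mG.
have m1 := measurable_mxM mI mA; have m2 := measurable_mxM m1 mI.
exact: (measurable_mxM m2 (measurable_mxT mA)).
Qed.

End MeasurableMatrices.

Section ManifoldMeasure.
Context {R : realType} {n : nat} {M : ptopologicalType}.
Variable X : smooth_manifold R n M.

Lemma measurable_dom i : measurable (dom X i : set (borel M)).
Proof. by apply: sub_sigma_algebra; exact: open_dom. Qed.

Lemma continuous_measurable_borel (D : set M) (f : M -> R) : open D ->
  (forall x, D x -> {for x, continuous f}) ->
  measurable_fun (D : set (borel M)) (f : borel M -> R).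
Proof.
move=> oD cf; apply: (measurability _ (RGenOpens.measurableE R)).
move=> _ [_ [a [b ->] <-]].
apply: sub_sigma_algebra; rewrite openE => x [Dx fx].
apply: filterI; first exact: open_nbhs_nbhs.
by apply: (cf x Dx); apply: open_nbhs_nbhs; split.
Qed.

(** Second countability gives an atlas of countably many charts. *)
Lemma countable_atlas : exists c : nat -> chart X, forall x, exists k, dom X (c k) x.
Proof.
have [B cB [oB nB]] := second_countable_manifold X.
have /countable_injP[f fB] := cB.
pose good k i := exists2 b, B b & f b = k /\ b `<=` dom X i.
pose c k := if pselect (exists i, good k i) is left e then projT1 (cid e)
            else chart_at X point.
exists c => x; have := nB x (dom X (chart_at X x)) => /(_ _)[].
  by apply: open_nbhs_nbhs; split; [exact: open_dom|exact: dom_chart_at].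
move=> b [Bb bx] bd; exists (f b); rewrite /c; case: pselect => [e|]; last first.
  by case; exists (chart_at X x), b.
case: (cid e) => i [b' Bb' [fb' b'd]] /=; apply: b'd.
suff -> : b' = b by [].
by apply: fB; rewrite ?inE.
Qed.

(** A comparison of densities in the charts gives one of the measures, on cutting a
    set into countably many disjoint pieces, each inside one chart. *)
Lemma volume_measure_le (g h : components X)
    (mu nu : {measure set (borel M) -> \bar R}) (k : R) : 0 < k ->
  volume_measure g mu -> volume_measure h nu ->
  (forall i x, dom X i x ->
     Num.sqrt (\det (g i x)) <= k * Num.sqrt (\det (h i x))) ->
  forall A : set (borel M), measurable A -> (mu A <= k%:E * nu A)%E.
Proof.
move=> k0 vg vh gh A mA.
have loc i (B : set (borel M)) : measurable B -> B `<=` dom X i ->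
    (mu B <= k%:E * nu B)%E.
  move=> mB Bi; rewrite (vg i B)// (vh i B)//.
  apply: lebesgue_int_le_scale => // y; rewrite ?patchE.
  - by case: ifP => // _; rewrite lee_fin sqrtr_ge0.
  - by case: ifP => // _; rewrite lee_fin sqrtr_ge0.
  - case: ifPn => [/set_mem[x Bx <-]|]; last by rewrite mule0.
    rewrite coordK; last exact: Bi.
    by rewrite -EFinM lee_fin gh//; exact: Bi.
have [c cX] := countable_atlas.
pose F k := A `&` dom X (c k).
have mF j : measurable (F j : set (borel M)).
  by apply: measurableI => //; exact: measurable_dom.
have mDF := seqDU_measurable mF.
have -> : A = \bigcup_j seqDU F j.
  rewrite -seqDU_bigcup_eq; apply/seteqP; split => [x Ax|x [j _ []]//].
  by have [j xj] := cX x; exists j.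
have mU : measurable (\bigcup_j seqDU F j : set (borel M)).
  exact: bigcupT_measurable.
rewrite !measure_semi_bigcup//; try exact: trivIset_seqDU.
rewrite -nneseriesZl//; apply: lee_nneseries => // j _.
apply: (loc (c j)) => //; apply: (subset_trans (@subset_seqDU _ _ _)).
exact: subIsetr.
Qed.

(** The cocycle [P] is the Jacobian for covariant tensors and its inverse transpose
    for the inverses of metrics; the two kinds of norms are thereby treated alike. *)
Definition transforms (P : chart X -> chart X -> M -> 'M[R]_n) (A : components X) :=
  forall i j x, dom X i x -> dom X j x -> A i x = P i j x *m A j x *m (P i j x)^T.

Lemma transforms_unit P (G : components X) :
  (forall i x, dom X i x -> posdef (G i x)) -> transforms P G ->
  forall i j x, dom X i x -> dom X j x -> P i j x \in unitmx.
Proof.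
move=> pG tG i j x xi xj; have := posdef_unit (pG i x xi).
by rewrite (tG i j x xi xj) !unitmx_mul => /andP[/andP[]].
Qed.

Lemma co_norm_at_chart P (G A : components X) :
  (forall i x, dom X i x -> posdef (G i x)) -> transforms P G -> transforms P A ->
  forall i x, dom X i x -> co_norm_at G A x = co_norm (G i x) (A i x).
Proof.
move=> pG tG tA i x xi; have xc := dom_chart_at X x.
rewrite /co_norm_at (tG _ i x xc xi) (tA _ i x xc xi) co_norm_congr//.
  exact: (transforms_unit pG tG).
exact: posdef_unit (pG i x xi).
Qed.

Lemma measurable_co_norm_at P (G A : components X) :
  (forall i x, dom X i x -> posdef (G i x)) -> transforms P G -> transforms P A ->
  measurable_components G -> measurable_components A ->
  measurable_fun (setT : set (borel M)) (co_norm_at G A : borel M -> R).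
Proof.
move=> pG tG tA mG mA; have [c cX] := countable_atlas.
have -> : setT = \bigcup_k (dom X (c k) : set (borel M)).
  by apply/seteqP; split => // x _; have [k xk] := cX x; exists k.
apply/measurable_fun_bigcup => k; first exact: measurable_dom.
apply: (eq_measurable_fun (fun x : borel M => co_norm (G (c k) x) (A (c k) x))).
  by move=> x /set_mem xk; rewrite (co_norm_at_chart pG tG tA xk).
by apply: measurable_co_norm; [exact: pG|exact: mG|exact: mA].
Qed.

End ManifoldMeasure.

(** * Time and space regularity of a Ricci flow *)

Section Shift.
Context {R : realType}.

Lemma cvg_near_eq {S : Type} {U : topologicalType} {F : set_system S} {FF : Filter F}
    (f g : S -> U) (y : U) :
  {near F, f =1 g} -> g x @[x --> F] --> y -> f x @[x --> F] --> y.
Proof. by move=> fg gy P /gy; apply: filterS2 fg => x /= <-. Qed.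

Lemma cvg_subfilter {S : Type} {U : topologicalType} {F G : set_system S}
    (f : S -> U) (y : U) :
  G `<=` F -> f x @[x --> G] --> y -> f x @[x --> F] --> y.
Proof. by move=> GF fy P /fy; exact: GF. Qed.

Lemma cvg_dnbhs_subr (t : R) : s - t @[s --> t^'] --> (0 : R)^'.
Proof.
move=> P [e /= e0 He]; exists e => //= s st sn; apply: He.
  by rewrite /= sub0r normrN distrC.
by rewrite subr_eq0.
Qed.

Lemma cvg_dnbhs_addr (t : R) : h + t @[h --> (0 : R)^'] --> t^'.
Proof.
move=> P [e /= e0 He]; exists e => //= s st sn; apply: He.
  by move: st; rewrite /= sub0r normrN opprD addrC subrK normrN.
by rewrite -subr_eq0 addrK.
Qed.

Lemma is_derive_of_quotient (q : R -> R) (t d : R) :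
  (s - t)^-1 * (q s - q t) @[s --> t^'] --> d -> is_derive t 1 q d.
Proof.
move=> qd.
have H : h^-1 *: ((q \o shift t) (h *: 1) - q t) @[h --> (0 : R)^'] --> d.
  have := @cvg_comp _ _ _ _ _ _ _ _ (@cvg_dnbhs_addr t) qd.
  apply: cvg_near_eq; apply: nearW => h /=.
  by rewrite addrK /GRing.scale/= mulr1.
by split; [apply/cvg_ex; exists d|exact: cvg_lim].
Qed.

Lemma derivable_quotient_cvg n (F : 'rV[R]_n -> R) (z e : 'rV[R]_n) (t : R) :
  derivable F z e ->
  (s - t)^-1 * (F (z + (s - t) *: e) - F z) @[s --> t^'] --> 'D_e F z.
Proof.
move=> /(@cvg_comp _ _ _ _ _ _ _ _ (@cvg_dnbhs_subr t)); apply: cvg_near_eq.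
by apply: nearW => s /=; rewrite [z + _]addrC.
Qed.

(** At [t = T] only times on the left are available; they suffice at all [t]. *)
Lemma within_dnbhs_proper (T t : R) : 0 < t <= T ->
  ProperFilter (within [set s | 0 < s <= T] t^').
Proof.
move=> /andP[t0 tT]; apply: Build_ProperFilter_ex => P.
rewrite /within/= => -[e /= e0 He].
pose m := Num.min (e / 2) (t / 2).
have m0 : 0 < m by rewrite lt_min !divr_gt0.
have me : m < e by rewrite gt_min; apply/orP; left; lra.
have mt : m < t by rewrite gt_min; apply/orP; right; lra.
exists (t - m); apply: He => /=.
- by rewrite opprB addrC subrK ger0_norm ?ltW.
- by rewrite -subr_eq0 addrAC subrr add0r oppr_eq0 gt_eqF.
- by rewrite subr_gt0 mt lerBlDr (le_trans tT)// lerDl ltW.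
Qed.

End Shift.

Section FlowRegularity.
Context {R : realType} {n : nat} {M : ptopologicalType}.
Variable X : smooth_manifold R n M.

Lemma metric_continuous (g : components X) i a b : riemannian_metric g ->
  forall x, dom X i x -> {for x, continuous (fun x => g i x a b)}.
Proof.
move=> [_ sg _] x xi; have [|U [F [oU Ux FU FE]]] := sg i a b (Defs.coord X i x).
  by exists x.
have ci : {for x, continuous (Defs.coord X i)}.
  have := @Defs.coord_continuous _ _ _ X i; rewrite continuous_open_subspace.
    by apply; rewrite inE.
  exact: open_dom.
have FC : {for x, continuous (F \o Defs.coord X i)}.
  by apply: continuous_comp => //; exact: (FU 0%N).
have E : \forall x' \near x, (F \o Defs.coord X i) x' = g i x' a b.
  near=> x'; have x'i : dom X i x'.
    by near: x'; apply: open_nbhs_nbhs; split => //; exact: open_dom.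
  have Ux' : U (Defs.coord X i x').
    by near: x'; apply: (ci U); exact: open_nbhs_nbhs.
  by rewrite /= (FE _ _ Ux') ?coordK//; exists x'.
rewrite /prop_for /continuous_at -(nbhs_singleton E).
apply: cvg_near_eq FC.
by apply: filterS E => x' /= ->.
Unshelve. all: by end_near. Qed.

Lemma metric_measurable (g : components X) : riemannian_metric g ->
  measurable_components g.
Proof.
move=> rg i a b; apply: continuous_measurable_borel; first exact: open_dom.
exact: metric_continuous.
Qed.

Variables (T : R) (l : R -> components X).
Hypothesis rf : ricci_flow T l.

Let metric t : 0 < t <= T -> riemannian_metric (l t).
Proof. by have [H _ _] := rf; exact: H. Qed.

Let rc t i x : 'M[R]_n := - (2 *: ricci (l t) i x).

Lemma flow_quotient_cvg t i x a b : 0 < t <= T -> dom X i x ->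
  (s - t)^-1 * (l s i x a b - l t i x a b)
    @[s --> within [set s | 0 < s <= T] t^'] --> rc t i x a b.
Proof.
have [_ _ H] := rf => tT xi.
have := @cvg_comp _ _ _ _ _ _ _ _ (H t tT i x xi)
  (@matrix_normedtype.coord_continuous R n n a b (- (2 *: ricci (l t) i x))).
move=> h; apply: cvg_near_eq h; apply: nearW => s /=.
by rewrite !mxE.
Qed.

Lemma flow_quotient_cvg_interior t i x a b : 0 < t < T -> dom X i x ->
  (s - t)^-1 * (l s i x a b - l t i x a b) @[s --> t^'] --> rc t i x a b.
Proof.
move=> /andP[t0 tT] xi.
have tT' : 0 < t <= T by rewrite t0 ltW.
have h := @flow_quotient_cvg t i x a b tT' xi.
apply: cvg_subfilter h => P.
rewrite /= /within/= => -[e /= e0 He].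
pose m := Num.min e (Num.min t (T - t)).
have m0 : 0 < m by rewrite !lt_min e0 t0 subr_gt0.
exists m => // s /=; rewrite !lt_min => /andP[se /andP[st sT]] sn.
apply: He => //=; move: st sT; rewrite !ltr_norml.
by move=> /andP[_ h1] /andP[h2 _]; apply/andP; split; [|apply: ltW]; lra.
Qed.

Lemma flow_is_derive t i x a b : 0 < t < T -> dom X i x ->
  is_derive t 1 (fun s => l s i x a b) (rc t i x a b).
Proof.
by move=> tT xi; apply: is_derive_of_quotient; exact: flow_quotient_cvg_interior.
Qed.

(** Joint smoothness provides an extension past the endpoint [T].  Its derivative in
    time agrees with the right-hand side of the flow equation at admissible times,
    because both are the limit of the same one-sided difference quotients. *)
Lemma flow_local_extension t i x a b : 0 < t <= T -> dom X i x ->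
  exists phi psi : R -> R,
    [/\ {for t, continuous phi}, {for t, continuous psi}
      & \forall s \near t, 0 < s <= T ->
          phi s = l s i x a b /\ psi s = rc s i x a b].
Proof.
move=> tT xi; have [_ sm _] := rf.
pose y := Defs.coord X i x.
pose z (s : R) : 'rV[R]_(1 + n) := row_mx s%:M y.
pose e := @basis_vec R (1 + n) (lshift n 0).
have zE r s : z s = z r + (s - r) *: e.
  apply/rowP => j; rewrite !mxE; case: splitP => k jk; rewrite ?mxE.
    have -> : j = lshift n 0 by apply: val_inj; rewrite /= jk ord1.
    by rewrite ord1 !eqxx !mulr1n mulr1 addrC subrK.
  have -> : (j == lshift n 0) = false.
    by apply/negbTE; rewrite -val_eqE /= jk.
  by rewrite andbF mulr0 addr0.
have Az s : 0 < s <= T -> [set z : 'rV[R]_(1 + n) |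
    0 < lsubmx z 0 0 <= T /\ (Defs.coord X i @` dom X i) (rsubmx z)] (z s).
  by move=> sT /=; rewrite /z row_mxKl row_mxKr scalar_mx11; split => //; exists x.
have [U [F [oU Uz FU FE]]] := sm i a b (z t) (Az t tT).
have FE' s : 0 < s <= T -> U (z s) -> F (z s) = l s i x a b.
  move=> sT Us; rewrite FE//; last exact: Az.
  by rewrite /z row_mxKl row_mxKr scalar_mx11 /y coordK.
have [dF cdF] := FU 1%N (lshift n 0).
have cz (s : R) : {for s, continuous z}.
  rewrite /prop_for /continuous_at.
  have : z s + (r - s) *: e @[r --> s] --> z s + (s - s) *: e.
    apply: cvgD; first exact: cvg_cst.
    by apply: cvgZr_tmp; apply: cvgB; [exact: cvg_id|exact: cvg_cst].
  rewrite subrr scale0r addr0; apply: cvg_near_eq; apply: nearW => r.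
  exact: zE.
have Unear s : U (z s) -> \forall r \near s, U (z r).
  by move=> Us; apply: (cz s U); exact: open_nbhs_nbhs.
exists (F \o z), ((fun z => 'D_e F z) \o z); split.
- by apply: continuous_comp; [exact: cz|exact: (FU 0%N)].
- by apply: continuous_comp; [exact: cz|exact: cdF].
apply: filterS (Unear t Uz) => s Us sT; split; first exact: FE'.
have WP := within_dnbhs_proper sT.
have h1 := derivable_quotient_cvg s (dF (z s) Us).
have h2 := @flow_quotient_cvg s i x a b sT xi.
apply: (cvg_unique _ _ h2) => //.
rewrite /=; apply: cvg_near_eq (@cvg_within_filter _ _ _ _ _ _ [set s | 0 < s <= T] h1).
rewrite near_withinE; near=> r => rT.
rewrite -zE !FE'//; near: r.
by apply: nbhs_dnbhs; exact: Unear.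
Unshelve. all: by end_near. Qed.

Lemma flow_continuous t i x a b : 0 < t <= T -> dom X i x ->
  l s i x a b @[s --> within [set s | 0 < s <= T] (nbhs t)] --> l t i x a b.
Proof.
move=> tT xi; have [phi [psi [cphi _ E]]] := @flow_local_extension t i x a b tT xi.
have [<- _] := nbhs_singleton E tT.
have c : phi s @[s --> within [set s | 0 < s <= T] (nbhs t)] --> phi t.
  exact: cvg_within_filter.
apply: cvg_near_eq c.
by rewrite near_withinE; apply: filterS E => s /[apply] -[].
Qed.

Lemma ricci_continuous t i x a b : 0 < t <= T -> dom X i x ->
  rc s i x a b @[s --> within [set s | 0 < s <= T] (nbhs t)] --> rc t i x a b.
Proof.
move=> tT xi; have [phi [psi [_ cpsi E]]] := @flow_local_extension t i x a b tT xi.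
have [_ <-] := nbhs_singleton E tT.
have c : psi s @[s --> within [set s | 0 < s <= T] (nbhs t)] --> psi t.
  exact: cvg_within_filter.
apply: cvg_near_eq c.
by rewrite near_withinE; apply: filterS E => s /[apply] -[].
Qed.

End FlowRegularity.

(** * Comparison of the metrics and volumes at two times *)

Section MatrixLimits.
Context {R : realType} {S : Type} {F : set_system S} {FF : Filter F}.

Lemma cvg_sumr (I : Type) (r : seq I) (f : I -> S -> R) (g : I -> R) :
  (forall i, f i x @[x --> F] --> g i) ->
  \sum_(i <- r) f i x @[x --> F] --> \sum_(i <- r) g i.
Proof.
move=> fg; elim: r => [|i r IH].
  by under eq_fun do rewrite big_nil; rewrite big_nil; exact: cvg_cst.
by under eq_fun do rewrite big_cons; rewrite big_cons; exact: cvgD.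
Qed.

Lemma cvg_mulmx_entry m n p q (P : 'M[R]_(m, n)) (Q : 'M[R]_(p, q))
    (A : S -> 'M[R]_(n, p)) (B : 'M[R]_(n, p)) a b :
  (forall c d, A s c d @[s --> F] --> B c d) ->
  (P *m A s *m Q) a b @[s --> F] --> (P *m B *m Q) a b.
Proof.
move=> AB; have E (C : 'M[R]_(n, p)) :
    (P *m C *m Q) a b = \sum_d (\sum_c P a c * C c d) * Q d b.
  by rewrite mxE; apply: eq_bigr => d _; rewrite mxE.
under eq_fun do rewrite E; rewrite E.
apply: cvg_sumr => d; apply: cvgMr_tmp; apply: cvg_sumr => c.
exact: cvgMl_tmp.
Qed.

Lemma cvg_co_norm n (G : 'M[R]_n) (A : S -> 'M[R]_n) (B : 'M[R]_n) :
  (forall c d, A s c d @[s --> F] --> B c d) ->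
  co_norm G (A s) @[s --> F] --> co_norm G B.
Proof.
move=> AB; rewrite /co_norm; suff h : \tr (invmx G *m A s *m invmx G *m (A s)^T)
    @[s --> F] --> \tr (invmx G *m B *m invmx G *m B^T).
  exact: (continuous_cvg _ (@sqrt_continuous R _) h).
have E (C : 'M[R]_n) : \tr (invmx G *m C *m invmx G *m C^T) =
    \sum_i \sum_k (invmx G *m C *m invmx G) i k * C i k.
  apply: eq_bigr => i _; rewrite mxE; apply: eq_bigr => k _.
  by rewrite [C^T _ _]mxE.
under eq_fun do rewrite E; rewrite E.
apply: cvg_sumr => i; apply: cvg_sumr => k; apply: cvgM => //.
exact: cvg_mulmx_entry.
Qed.

End MatrixLimits.

Section FlowComparison.
Context {R : realType} {n : nat} {M : ptopologicalType}.
Variable X : smooth_manifold R n M.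
Variables (T : R) (l : R -> components X).
Hypothesis rf : ricci_flow T l.

Let metric t : 0 < t <= T -> riemannian_metric (l t).
Proof. by have [H _ _] := rf; exact: H. Qed.

Lemma flow_posdef t : 0 < t <= T -> forall i x, dom X i x -> posdef (l t i x).
Proof. by move=> /metric[]. Qed.

Definition jacobian_cocycle (i j : chart X) (x : M) : 'M[R]_n :=
  'J (Defs.coord X j \o param X i) (Defs.coord X i x).

Definition inverse_cocycle (i j : chart X) (x : M) : 'M[R]_n :=
  (invmx (jacobian_cocycle i j x))^T.

Lemma flow_transforms t : 0 < t <= T -> transforms jacobian_cocycle (l t).
Proof. by move=> /metric[]. Qed.

Lemma transforms_inv (g : components X) :
  (forall i x, dom X i x -> posdef (g i x)) ->
  transforms jacobian_cocycle g -> transforms inverse_cocycle (inv_tensor g).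
Proof.
move=> pg tg i j x xi xj; rewrite /inv_tensor (tg i j x xi xj) invmx_congr.
- by rewrite /inverse_cocycle trmxK.
- exact: (transforms_unit pg tg).
- exact: posdef_unit (pg j x xj).
Qed.

(** The coordinate Ricci tensor transforms as a tensor because it is, up to a
    factor, the time derivative of the metric in every chart. *)
Lemma ricci_transforms t : 0 < t <= T -> transforms jacobian_cocycle (ricci (l t)).
Proof.
move=> tT i j x xi xj; have WP := within_dnbhs_proper tT.
pose J := jacobian_cocycle i j x.
pose q (k : chart X) s : 'M[R]_n := (s - t)^-1 *: (l s k x - l t k x).
have qE k (xk : dom X k x) a b : q k s a b
    @[s --> within [set s | 0 < s <= T] t^'] --> (- (2 *: ricci (l t) k x)) a b.
  have h := @flow_quotient_cvg _ _ _ X T l rf t k x a b tT xk.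
  apply: cvg_near_eq h.
  by apply: nearW => s; rewrite !mxE.
have main : - (2 *: ricci (l t) i x) = J *m (- (2 *: ricci (l t) j x)) *m J^T.
  apply/matrixP => a b; apply: (cvg_unique _ (qE i xi a b)) => //.
  have h := @cvg_mulmx_entry R _ _ WP _ _ _ _ J J^T (q j) _ a b (qE j xj).
  apply: cvg_near_eq h.
  rewrite near_withinE; apply: nearW => s sT.
  rewrite /q (flow_transforms sT xi xj) (flow_transforms tT xi xj).
  by rewrite -mulmxBl -mulmxBr -scalemxAr -scalemxAl.
have two0 : (2 : R) != 0 by rewrite pnatr_eq0.
apply: (scalerI two0); apply: oppr_inj; rewrite main.
by rewrite mulmxN mulNmx -scalemxAr -scalemxAl.
Qed.

Lemma flow_measurable t : 0 < t <= T -> measurable_components (l t).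
Proof. by move=> /metric; exact: metric_measurable. Qed.

(** A pointwise limit of difference quotients in time of measurable fields. *)
Lemma ricci_measurable t : 0 < t <= T -> measurable_components (ricci (l t)).
Proof.
move=> tT i a b; have /andP[t0 tT'] := tT.
pose s k := t - t / k.+2%:R.
have sT k : 0 < s k <= T.
  have : 0 < t / k.+2%:R < t.
    by rewrite divr_gt0//= ltr_pdivrMr// ltr_pMr// ltr1n.
  by rewrite /s; set u := t / _ => /andP[h1 h2]; apply/andP; split; lra.
have sW : s k @[k --> \oo] --> within [set s | 0 < s <= T] t^'.
  move=> P; rewrite /within/= => -[e /= e0 He].
  suff : \forall k \near \oo, P (s k) by [].
  near=> k; apply: He => //=.
    rewrite /s opprB addrC subrK ger0_norm ?divr_ge0 ?(ltW t0)//.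
    rewrite ltr_pdivrMr// mulrC -ltr_pdivrMr//; near: k.
    exists (Num.trunc (t / e)) => // k /= ek.
    rewrite (lt_le_trans (truncnS_gt _))// ler_nat.
    by rewrite (leq_trans (n := k.+1)).
  by rewrite /s -subr_eq0 addrAC subrr add0r oppr_eq0 mulf_neq0 ?gt_eqF.
have m (k : nat) : measurable_fun (dom X i : set (borel M))
   (fun x : borel M => - (2^-1) * ((s k - t)^-1 * (l (s k) i x a b - l t i x a b))).
  apply: measurable_funM; first exact: measurable_cst.
  apply: measurable_funM; first exact: measurable_cst.
  by apply: measurable_funB; exact: flow_measurable.
apply: (measurable_fun_cvg m) => x xi.
rewrite (_ : ricci (l t) i x a b = - 2^-1 * (- (2 *: ricci (l t) i x)) a b); last first.
  by rewrite !mxE; field.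
apply: cvgMl_tmp.
exact: (@cvg_comp _ _ _ _ _ _ _ _ sW (@flow_quotient_cvg _ _ _ X T l rf t i x a b tT xi)).
Unshelve. all: by end_near. Qed.

Lemma flow_within_continuous r t (f : R -> R) : 0 < r -> t <= T ->
  (forall s, 0 < s <= T ->
    f u @[u --> within [set u | 0 < u <= T] (nbhs s)] --> f s) ->
  {within `[r, t], continuous f}.
Proof.
move=> r0 tT cf; apply/subspace_continuousP => s /=; rewrite in_itv/= => /andP[rs st].
have sT : 0 < s <= T by rewrite (lt_le_trans r0 rs) (le_trans st tT).
apply: cvg_subfilter (cf s sT) => P; rewrite /within/=; apply: filterS => u Pu.
rewrite in_itv/= => /andP[ru ut]; apply: Pu.
by rewrite (lt_le_trans r0 ru) (le_trans ut tT).
Qed.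

Variable al : R.
Hypothesis ricci_le : forall t, 0 < t <= T -> forall x : M,
  co_norm_at (l t) (ricci (l t)) x <= al / t.

(** In a chart, the derivative of [l s (v, v)] in time is [-2 ric (v, v)], of absolute
    value at most [2 al / s * l s (v, v)]. *)
Lemma flow_qform_gronwall i x v r t : dom X i x -> 0 < r -> r <= t -> t <= T ->
  qform (l r i x) v <= (t / r) `^ (2 * al) * qform (l t i x) v /\
  qform (l t i x) v <= (t / r) `^ (2 * al) * qform (l r i x) v.
Proof.
move=> xi r0 rt tT.
pose q s := qform (l s i x) v.
pose dq s := qform (- (2 *: ricci (l s) i x)) v.
apply: (@gronwall_powR R q dq r t (2 * al) r0 rt).
- move=> s /andP[rs st]; apply: is_derive_of_quotient.
  have s0 : 0 < s by exact: lt_trans rs.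
  have sT : s < T by exact: lt_le_trans tT.
  have sT' : 0 < s < T by rewrite s0.
  have sT'' : 0 < s <= T by rewrite s0 ltW.
  have h c d : ((u - s)^-1 *: (l u i x - l s i x)) c d @[u --> s^'] -->
      (- (2 *: ricci (l s) i x)) c d.
    have := @flow_quotient_cvg_interior _ _ _ X T l rf s i x c d sT' xi.
    by apply: cvg_near_eq; apply: nearW => u; rewrite !mxE.
  have H := @cvg_mulmx_entry R _ _ _ _ _ _ _ v v^T _ _ 0 0 h.
  apply: cvg_near_eq (H _); apply: nearW => u.
  by rewrite -/(qform _ v) qformZ qformB.
- apply: flow_within_continuous => // s sT.
  by apply: cvg_mulmx_entry => c d; exact: flow_continuous.
- move=> s /andP[rs st].
  have s0 : 0 < s by exact: lt_trans rs.
  have sT : 0 < s <= T by rewrite s0 ltW// (lt_le_trans st tT).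
  rewrite /dq -scaleNr qformZ normrM normrN (ger0_norm (ler0n _ 2)).
  rewrite -mulrA -mulrA ler_pM2l//.
  have pG := flow_posdef sT xi.
  apply: (le_trans (qform_le_co_norm _ _ pG)).
  rewrite mulrA ler_wpM2r ?posdef_qform_ge0//.
  rewrite -(co_norm_at_chart (flow_posdef sT) (flow_transforms sT) (ricci_transforms sT) xi).
  exact: ricci_le.
Qed.

Lemma flow_loewner r t i x : dom X i x -> 0 < r -> r <= t -> t <= T ->
  loewner_le (l r i x) ((t / r) `^ (2 * al) *: l t i x) /\
  loewner_le (l t i x) ((t / r) `^ (2 * al) *: l r i x).
Proof.
move=> xi r0 rt tT; split => v; rewrite qformZ.
  by have [] := flow_qform_gronwall v xi r0 rt tT.
by have [] := flow_qform_gronwall v xi r0 rt tT.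
Qed.

Variable vol : R -> {measure set (borel M) -> \bar R}.
Hypothesis volE : forall t, 0 < t <= T -> volume_measure (l t) (vol t).

Lemma sqrt_det_loewner_le (c : R) (G H : 'M[R]_n) : posdef G -> posdef H ->
  0 <= c -> loewner_le G (c `^ 2 *: H) ->
  Num.sqrt (\det G) <= c ^+ n * Num.sqrt (\det H).
Proof.
move=> pG pH c0 GH.
have := det_loewner_le pG pH (powR_ge0 _ _) GH.
rewrite powR_mulrn// -exprM mulnC exprM => h.
rewrite -[c ^+ n]ger0_norm ?exprn_ge0// -sqrtr_sqr -sqrtrM ?sqr_ge0//.
exact: ler_wsqrtr.
Qed.

Lemma flow_volume_le r t : 0 < r -> r <= t -> t <= T ->
  forall A : set (borel M), measurable A ->
    (vol r A <= ((t / r) `^ (al * n%:R))%:E * vol t A)%E /\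
    (vol t A <= ((t / r) `^ (al * n%:R))%:E * vol r A)%E.
Proof.
move=> r0 rt tT A mA; have t0 := lt_le_trans r0 rt.
have c0 : 0 < (t / r) `^ al by rewrite powR_gt0// divr_gt0.
rewrite powRrM powR_mulrn ?(ltW c0)//.
have rT : 0 < r <= T by rewrite r0 (le_trans rt tT).
have tT' : 0 < t <= T by rewrite t0.
split; apply: (volume_measure_le _ (volE _) (volE _)) => //; rewrite ?exprn_gt0//.
- move=> i x xi; apply: sqrt_det_loewner_le; rewrite ?(ltW c0)//.
  + exact: flow_posdef.
  + exact: flow_posdef.
  + by rewrite -powRrM [al * 2]mulrC; have [] := flow_loewner xi r0 rt tT.
- move=> i x xi; apply: sqrt_det_loewner_le; rewrite ?(ltW c0)//.
  + exact: flow_posdef.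
  + exact: flow_posdef.
  + by rewrite -powRrM [al * 2]mulrC; have [] := flow_loewner xi r0 rt tT.
Qed.

End FlowComparison.

(** * The metric moves little in L^p between comparable times *)

Section TwoTimes.
Context {R : realType} {n : nat} {M : ptopologicalType}.
Variable X : smooth_manifold R n M.
Variables (T : R) (l : R -> components X).
Hypothesis rf : ricci_flow T l.
Variable al : R.
Hypotheses (T0 : 0 < T) (al0 : 0 < al).
Hypothesis ricci_le : forall t, 0 < t <= T -> forall x : M,
  co_norm_at (l t) (ricci (l t)) x <= al / t.
Variable vol : R -> {measure set (borel M) -> \bar R}.
Hypothesis volE : forall t, 0 < t <= T -> volume_measure (l t) (vol t).
Hypothesis ricci_int : forall t, 0 < t <= T ->
  (\int[vol t]_x (co_norm_at (l t) (ricci (l t)) x)%:E <= al%:E)%E.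
Variable p : R.
Hypothesis p1 : 1 <= p.

Let p0 : 0 < p. Proof. exact: lt_le_trans p1. Qed.

Let TT : 0 < T <= T. Proof. by rewrite T0 lexx. Qed.

Lemma co_norm_at_ge0 (G A : components X) (x : M) : 0 <= co_norm_at G A x.
Proof. exact: co_norm_ge0. Qed.

Definition ricci_Lp_bound (t : R) : R :=
  (T / t) `^ (al * (2 * p + n%:R)) * (al * (al / t) `^ (p - 1)).

Lemma ricci_Lp_bound_ge0 t : 0 <= ricci_Lp_bound t.
Proof. by rewrite /ricci_Lp_bound !mulr_ge0 ?powR_ge0 ?(ltW al0). Qed.

Lemma ricci_Lp_bound_le r t : 0 < r -> r <= t ->
  ricci_Lp_bound t <= ricci_Lp_bound r.
Proof.
move=> r0 rt; have t0 := lt_le_trans r0 rt.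
have inv : t^-1 <= r^-1 by rewrite lef_pV2 ?posrE.
have mono c e : 0 <= c -> 0 <= e -> (c / t) `^ e <= (c / r) `^ e.
  move=> c0 e0; rewrite ge0_ler_powR ?nnegrE ?divr_ge0 ?ler_wpM2l//.
  - exact: ltW.
  - exact: ltW.
apply: ler_pM; rewrite ?mulr_ge0 ?powR_ge0 ?(ltW al0)//.
  apply: mono; rewrite ?(ltW T0)// mulr_ge0 ?(ltW al0)//.
  by rewrite addr_ge0// mulr_ge0// ltW.
by rewrite ler_wpM2l ?(ltW al0)// mono ?(ltW al0)// subr_ge0.
Qed.

(** Interpolation: the pointwise bound [al / t] raises the L^1 bound to an L^p
    bound; passing from the metric at time [t] to the one at time [T] costs a
    power of [T / t]. *)
Lemma ricci_Lnorm_le t : 0 < t <= T ->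
  ('N[vol T]_p%:E[EFin \o co_norm_at (l T) (ricci (l t))]
     <= (ricci_Lp_bound t `^ p^-1)%:E)%E.
Proof.
move=> tT; have /andP[t0 tT'] := tT.
have At0 : 0 < T / t by rewrite divr_gt0.
rewrite Lnorm_le_powR ?powR_ge0// -powRrM mulVf ?gt_eqF// powRr1 ?ricci_Lp_bound_ge0//.
pose k := ((T / t) `^ (2 * al)) `^ p * (al / t) `^ (p - 1).
have k0 : 0 < k by rewrite mulr_gt0// !powR_gt0// divr_gt0.
pose rho (x : M) := co_norm_at (l t) (ricci (l t)) x.
pose c := (T / t) `^ (al * n%:R).
apply: (@le_trans _ _ ((c * k)%:E * \int[vol t]_x (rho x)%:E)%E).
  apply: ge0_le_integral_scale => //; rewrite ?powR_ge0//.
  - by move=> A mA; have [] := flow_volume_le rf ricci_le volE t0 tT' (lexx T) mA.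
  - by move=> x; rewrite lee_fin co_norm_at_ge0.
  - move=> x; rewrite -EFinM lee_fin ger0_norm ?co_norm_at_ge0//.
    have H : co_norm_at (l T) (ricci (l t)) x <= (T / t) `^ (2 * al) * rho x.
      have xc := dom_chart_at X x.
      apply: co_norm_loewner_le.
      + exact: (flow_posdef rf tT xc).
      + exact: (flow_posdef rf TT xc).
      + exact: powR_gt0.
      + by have [] := flow_loewner rf ricci_le xc t0 tT' (lexx T).
    apply: (@le_trans _ _ (((T / t) `^ (2 * al) * rho x) `^ p)).
      by rewrite ge0_ler_powR ?(ltW p0)// nnegrE ?mulr_ge0 ?powR_ge0 ?co_norm_at_ge0.
    rewrite powRM ?powR_ge0 ?co_norm_at_ge0// -mulrA ler_wpM2l ?powR_ge0//.
    rewrite -mulr_powRB1 ?co_norm_at_ge0// mulrC ler_wpM2r ?co_norm_at_ge0//.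
    rewrite ge0_ler_powR ?subr_ge0 ?nnegrE ?co_norm_at_ge0 ?ricci_le//.
    by rewrite divr_ge0 ?ltW.
apply: (le_trans (lee_wpmul2l _ (ricci_int tT))).
  by rewrite lee_fin mulr_ge0 ?powR_ge0 ?(ltW k0).
rewrite -EFinM lee_fin /ricci_Lp_bound /k /c le_eqVlt; apply/orP; left; apply/eqP.
rewrite -powRrM mulrDr [in RHS](@powRD _ (T / t)); last first.
  by rewrite (gt_eqF At0) implybT.
rewrite (_ : al * (2 * p) = 2 * al * p); last by ring.
move: (_ `^ _) (_ `^ _) (_ `^ _) => u v w; ring.
Qed.

Section RiemannSum.
Variables r s : R.

Let h m : R := (s - r) / m.+1%:R.

(** Approximates [l s - l r], the integral of [-2 ric] from [r] to [s]. *)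
Definition ricci_riemann_sum m : components X := fun i x =>
  \sum_(k < m.+1) (- (h m * 2)) *: ricci (l (r + h m * k%:R)) i x.

Hypotheses (r0 : 0 < r) (rs : r < s) (sT : s <= T).

Let h0 m : 0 < h m. Proof. by rewrite divr_gt0 ?subr_gt0. Qed.

Let tau_itv m k : (k < m.+1)%N -> r <= r + h m * k%:R <= s.
Proof.
move=> km; rewrite lerDl mulr_ge0 ?(ltW (h0 m))//= -lerBrDl.
have -> : s - r = h m * m.+1%:R by rewrite /h divfK.
by rewrite ler_wpM2l ?(ltW (h0 m))// ler_nat ltnW.
Qed.

Let tauT m k : (k < m.+1)%N -> 0 < r + h m * k%:R <= T.
Proof.
by move=> /tau_itv/andP[h1 h2]; rewrite (lt_le_trans r0 h1) (le_trans h2 sT).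
Qed.

Lemma ricci_riemann_sum_transforms m :
  transforms (@jacobian_cocycle R n M X) (ricci_riemann_sum m).
Proof.
move=> i j x xi xj; rewrite /ricci_riemann_sum mulmx_sumr mulmx_suml.
apply: eq_bigr => k _; rewrite (ricci_transforms rf (tauT (ltn_ord k)) xi xj).
by rewrite -scalemxAr -scalemxAl.
Qed.

Lemma ricci_riemann_sum_measurable m : measurable_components (ricci_riemann_sum m).
Proof.
move=> i; apply: measurable_mx_sum => k.
apply: (measurable_mxZ (c := fun=> - (h m * 2))); first exact: measurable_cst.
exact: (ricci_measurable rf (tauT (ltn_ord k))).
Qed.

Lemma cvg_ricci_riemann_sum x :
  co_norm_at (l T) (ricci_riemann_sum m) x @[m --> \oo] -->
  co_norm_at (l T) (sub_tensor (l s) (l r)) x.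
Proof.
have xc := dom_chart_at X x.
apply: cvg_co_norm => a b.
have := @cvg_riemann_sum R (fun u => l u (chart_at X x) x a b)
  (fun u => (- (2 *: ricci (l u) (chart_at X x) x)) a b) r s rs.
rewrite (_ : sub_tensor _ _ _ _ a b = l s (chart_at X x) x a b - l r (chart_at X x) x a b); last by rewrite !mxE.
move=> H; apply: cvg_near_eq (H _ _ _).
- apply: nearW => m; rewrite summxE; apply: eq_bigr => k _.
  by rewrite mxE [in RHS]mxE [in RHS]mxE mulrN mulNr mulrA.
- move=> u /andP[ru us]; apply: (@flow_is_derive _ _ _ X T l rf) => //.
  by rewrite (lt_trans r0 ru) (lt_le_trans us sT).
- by apply: (flow_within_continuous r0 sT) => u uT; exact: (@flow_continuous _ _ _ X T l rf).
- by apply: (flow_within_continuous r0 sT) => u uT; exact: (@ricci_continuous _ _ _ X T l rf).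
Qed.

(** Minkowski's inequality for the Riemann sums and Fatou's lemma in the limit stand
    in for Minkowski's integral inequality. *)
Lemma two_time_Lnorm_lt K : 0 <= K ->
  (forall t, r <= t <= s ->
    ('N[vol T]_p%:E[EFin \o co_norm_at (l T) (ricci (l t))] <= K%:E)%E) ->
  ('N[vol T]_p%:E[EFin \o co_norm_at (l T) (sub_tensor (l s) (l r))]
     <= (2 * (s - r) * K)%:E)%E.
Proof.
move=> K0 fK; have sr0 : 0 < s - r by rewrite subr_gt0.
have mric t : 0 < t <= T -> measurable_fun (setT : set (borel M))
    (co_norm_at (l T) (ricci (l t)) : borel M -> R).
  move=> tT; apply: (measurable_co_norm_at (flow_posdef rf TT)
    (flow_transforms rf TT) (ricci_transforms rf tT)).
    exact: (flow_measurable rf TT).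
  exact: (ricci_measurable rf).
apply: (@Lnorm_fatou _ (borel M) R (vol T) p _
    (fun m => co_norm_at (l T) (ricci_riemann_sum m))) => //.
- by rewrite !mulr_ge0// ltW.
- move=> m; apply: (measurable_co_norm_at (flow_posdef rf TT)
    (flow_transforms rf TT) (ricci_riemann_sum_transforms m)).
    exact: (flow_measurable rf TT).
  exact: ricci_riemann_sum_measurable.
- exact: cvg_ricci_riemann_sum.
move=> m.
pose tau k := r + h m * (minn k m)%:R.
have tauE (k : 'I_m.+1) : tau k = r + h m * k%:R.
  by rewrite /tau (minn_idPl _) // -ltnS.
have tT k : 0 < tau k <= T by apply: tauT; rewrite ltnS geq_minr.
pose F k (x : borel M) := h m * 2 * co_norm_at (l T) (ricci (l (tau k))) x.
have hm2 : 0 < h m * 2 by rewrite mulr_gt0.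
apply: (@le_trans _ _ ('N[vol T]_p%:E[EFin \o (fun x => \sum_(k < m.+1) F k x)%R])%E).
  rewrite -[leRHS]mul1e; apply: Lnorm_le_mul => // x; rewrite co_norm_at_ge0 mul1r/=.
  have pT := flow_posdef rf TT (dom_chart_at X x).
  apply: (le_trans (co_norm_sum _ pT)); apply: ler_sum => k _.
  by rewrite /F tauE co_normZ normrN (gtr0_norm hm2) lexx.
have -> : 2 * (s - r) * K = m.+1%:R * (h m * 2 * K).
  by rewrite /h; field.
apply: Lnorm_sum_le => //.
- by rewrite mulr_ge0// ltW.
- move=> k; apply: measurable_funM; first exact: measurable_cst.
  exact: mric.
move=> k km; apply: (@le_trans _ _ ((h m * 2)%:E *
    'N[vol T]_p%:E[EFin \o co_norm_at (l T) (ricci (l (tau k)))])%E).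
  apply: Lnorm_le_mul => // x; rewrite lexx andbT mulr_ge0 ?co_norm_at_ge0//.
  exact: ltW.
rewrite [leRHS]EFinM; apply: lee_wpmul2l; first by rewrite lee_fin ltW.
by apply: fK; apply: tau_itv; rewrite ltnS geq_minr.
Qed.

End RiemannSum.

(** The deviation between two times, enlarged so as to dominate also the
    deviation of the inverse metrics. *)
Definition deviation (r s : R) (x : M) : R :=
  (T / r) `^ (4 * al) * co_norm_at (l T) (sub_tensor (l s) (l r)) x.

Lemma deviation_ge0 r s x : 0 <= deviation r s x.
Proof. by rewrite mulr_ge0 ?powR_ge0 ?co_norm_at_ge0. Qed.

Lemma deviation_measurable r s : 0 < r <= T -> 0 < s <= T ->
  measurable_fun (setT : set (borel M)) (deviation r s : borel M -> R).
Proof.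
move=> rT sT; apply: measurable_funM; first exact: measurable_cst.
apply: (measurable_co_norm_at (flow_posdef rf TT) (flow_transforms rf TT)).
- move=> i j x xi xj; rewrite /sub_tensor (flow_transforms rf rT xi xj).
  by rewrite (flow_transforms rf sT xi xj) mulmxBr mulmxBl.
- exact: (flow_measurable rf TT).
- move=> i; apply: (measurable_mxB (D := dom X i : set (borel M))).
    exact: (flow_measurable rf sT).
  exact: (flow_measurable rf rT).
Qed.

Lemma co_norm_le_deviation r s x : 0 < r -> r <= s -> s <= T ->
  co_norm_at (l T) (sub_tensor (l s) (l r)) x <= deviation r s x.
Proof.
move=> r0 rs sT; rewrite -[leLHS]mul1r ler_wpM2r ?co_norm_at_ge0//.
rewrite -[leLHS](powRr0 (T / r)) ler_powR ?mulr_ge0 ?(ltW al0)//.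
by rewrite ler_pdivlMr// mul1r (le_trans rs).
Qed.

Lemma contra_norm_le_deviation r s x : 0 < r -> r <= s -> s <= T ->
  contra_norm_at (l T) (sub_tensor (inv_tensor (l s)) (inv_tensor (l r))) x
    <= deviation r s x.
Proof.
move=> r0 rs sT; have s0 := lt_le_trans r0 rs.
have xc := dom_chart_at X x.
have rT : 0 < r <= T by rewrite r0 (le_trans rs).
have sT' : 0 < s <= T by rewrite s0.
have A1 u : 0 < u <= T -> 0 < (T / u) `^ (2 * al).
  by move=> /andP[u0 _]; rewrite powR_gt0// divr_gt0.
have L u : 0 < u <= T -> loewner_le (l T (chart_at X x) x)
    ((T / u) `^ (2 * al) *: l u (chart_at X x) x).
  by move=> /andP[u0 uT]; have [] := flow_loewner rf ricci_le xc u0 uT (lexx T).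
apply: (le_trans (contra_norm_inv_sub_le _ _ _ (A1 s sT') (A1 r rT) (L s sT') (L r rT))).
- exact: (flow_posdef rf TT xc).
- exact: (flow_posdef rf sT' xc).
- exact: (flow_posdef rf rT xc).
rewrite ler_wpM2r ?co_norm_ge0//.
rewrite (_ : 4 * al = 2 * al + 2 * al); last by ring.
rewrite powRD; last by rewrite (gt_eqF (divr_gt0 T0 r0)) implybT.
rewrite ler_wpM2r ?powR_ge0// ge0_ler_powR ?mulr_ge0 ?(ltW al0)// ?nnegrE ?divr_ge0 ?(ltW T0) ?(ltW r0) ?(ltW s0)//.
by rewrite ler_wpM2l ?(ltW T0)// lef_pV2 ?posrE.
Qed.

Hypothesis alE : al * (6 * p + n%:R) = 2^-1.

Definition deviation_bound : R := 6 * al * T `^ p^-1.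

Lemma deviation_bound_ge0 : 0 <= deviation_bound.
Proof. by rewrite !mulr_ge0 ?powR_ge0// ltW. Qed.

(** With [s - r <= 3 r], the length of the time interval compensates the blow-up
    of the curvature; the choice of [al] leaves the positive power [1 / (2 p)]. *)
Lemma deviation_Lnorm_le r s : 0 < r -> r <= s -> s <= 4 * r -> s <= T ->
  ('N[vol T]_p%:E[EFin \o deviation r s]
     <= (deviation_bound * (r / T) `^ (2 * p)^-1)%:E)%E.
Proof.
move=> r0 rs s4 sT.
have A0 : 0 < T / r by rewrite divr_gt0.
pose K := ricci_Lp_bound r `^ p^-1.
have K0 : 0 <= K by exact: powR_ge0.
have H : ('N[vol T]_p%:E[EFin \o co_norm_at (l T) (sub_tensor (l s) (l r))]
     <= (2 * (s - r) * K)%:E)%E.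
  move: rs; rewrite le_eqVlt => /predU1P[rs|rs].
    rewrite -{}rs subrr mulr0 mul0r Lnorm_le_powR// powR0 ?gt_eqF//.
    under eq_integral => x _.
      rewrite (_ : co_norm_at _ _ _ = 0); last first.
        by rewrite /co_norm_at /sub_tensor subrr co_norm0.
      rewrite normr0 powR0 ?gt_eqF//; over.
    by rewrite integral0.
  apply: two_time_Lnorm_lt => // t /andP[rt ts].
  have tT : 0 < t <= T by rewrite (lt_le_trans r0 rt) (le_trans ts sT).
  apply: (le_trans (ricci_Lnorm_le tT)); rewrite lee_fin.
  by rewrite ge0_ler_powR ?invr_ge0 ?(ltW p0) ?nnegrE ?ricci_Lp_bound_ge0//
    ricci_Lp_bound_le.
apply: (@le_trans _ _ (((T / r) `^ (4 * al))%:E *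
  'N[vol T]_p%:E[EFin \o co_norm_at (l T) (sub_tensor (l s) (l r))])%E).
  by apply: Lnorm_le_mul; rewrite ?powR_gt0// => x; rewrite lexx deviation_ge0.
apply: (le_trans (lee_wpmul2l _ H)); first by rewrite lee_fin powR_ge0.
rewrite -EFinM lee_fin.
apply: (@le_trans _ _ ((T / r) `^ (4 * al) * (6 * r * K))).
  by rewrite ler_wpM2l ?powR_ge0// ler_wpM2r//; lra.
have KE : K = (T / r) `^ (al * (2 * p + n%:R) / p) * (al / r * r `^ p^-1).
  rewrite /K /ricci_Lp_bound powRM ?mulr_ge0 ?powR_ge0 ?(ltW al0)//.
  rewrite -powRrM; congr (_ * _).
  have -> : al * (al / r) `^ (p - 1) = (al / r) `^ p * r.
    have ar0 : 0 <= al / r by rewrite divr_ge0 ?(ltW al0) ?(ltW r0).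
    by rewrite -(mulr_powRB1 ar0 p0); field; rewrite gt_eqF.
  rewrite powRM ?powR_ge0 ?(ltW r0)// -powRrM divff ?gt_eqF// powRr1//.
  by rewrite divr_ge0 ?(ltW al0) ?(ltW r0).
have -> : (T / r) `^ (4 * al) * (6 * r * K) =
    6 * al * (r `^ p^-1 * (T / r) `^ (2 * p)^-1).
  have -> : (2 * p)^-1 = 4 * al + al * (2 * p + n%:R) / p.
    have -> : 4 * al + al * (2 * p + n%:R) / p = al * (6 * p + n%:R) / p.
      by field; rewrite gt_eqF.
    by rewrite alE invfM.
  rewrite KE powRD; last by rewrite (gt_eqF A0) implybT.
  by field; rewrite gt_eqF.
rewrite /deviation_bound -[leRHS]mulrA ler_wpM2l ?mulr_ge0 ?(ltW al0)//.
have rTE : r = T * (r / T) by field; rewrite gt_eqF.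
have rT0 : 0 < r / T by rewrite divr_gt0.
rewrite {1}rTE powRM ?(ltW T0) ?(ltW rT0)// -mulrA ler_wpM2l ?powR_ge0//.
have -> : T / r = (r / T)^-1 by rewrite invf_div.
rewrite -[(r / T)^-1]powR_inv1 ?(ltW rT0)// -powRrM mulN1r -powRD; last first.
  by rewrite (gt_eqF rT0) implybT.
by rewrite (_ : p^-1 - _ = (2 * p)^-1)//; field; rewrite gt_eqF.
Qed.

End TwoTimes.

(** * Limits of sequences of inner products *)

Lemma mx_subE (V : zmodType) m n (A B : 'M[V]_(m, n)) a b :
  (A - B) a b = A a b - B a b.
Proof. by rewrite mxE [in LHS]mxE. Qed.

Section SequencesOfInnerProducts.
Context {R : realType} {n : nat}.
Variables (G : 'M[R]_n) (g : nat -> 'M[R]_n) (d : nat -> R) (B : R).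
Hypotheses (pG : posdef G) (pg : forall k, posdef (g k)).
Hypothesis co_d : forall k, co_norm G (g k - g k.+1) <= d k.
Hypothesis contra_d : forall k, contra_norm G (invmx (g k) - invmx (g k.+1)) <= d k.
Hypothesis sum_d : forall m, \sum_(j < m) d j <= B.

Definition mx_lim : 'M[R]_n := \matrix_(a, b) lim (g k a b @[k --> \oo]).

(** The entries have summable increments. *)
Lemma mx_limP a b : g k a b @[k --> \oo] --> mx_lim a b.
Proof.
rewrite mxE; pose u (k : nat) : R := g k a b; pose c := Num.sqrt (G a a * G b b).
have ud k : `|telescope u k| <= c * d k.
  rewrite /telescope /u distrC; have := entry_le_co_norm (g k - g k.+1) a b pG.
  rewrite !mxE => /le_trans; apply; rewrite ler_wpM2l ?sqrtr_ge0//.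
have : cvgn [normed series (telescope u)].
  apply: nondecreasing_is_cvgn.
    by apply: nondecreasing_series => i _ _; exact: normr_ge0.
  exists (c * B) => _ [k _ <-].
  have -> : [normed series (telescope u)] k = \sum_(j < k) `|telescope u j|.
    by rewrite -(big_mkord xpredT (fun j => `|telescope u j|)).
  apply: (@le_trans _ _ (\sum_(j < k) c * d j)); first exact: ler_sum.
  by rewrite -mulr_sumr ler_wpM2l ?sqrtr_ge0.
move=> /(@normed_cvg R R); rewrite telescopeK => /cvg_ex[y yE].
apply/cvg_ex; exists (y + u 0%N).
have h : (u k - u 0%N) + u 0%N @[k --> \oo] --> y + u 0%N.
  by apply: cvgD; [exact: yE|exact: cvg_cst].
by apply: cvg_near_eq h; apply: nearW => k; rewrite subrK.
Qed.

Lemma co_norm_steps_le k m :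
  co_norm G (g k - g (k + m)%N) <= \sum_(j < m) d (k + j)%N.
Proof.
elim: m => [|m IH]; first by rewrite addn0 subrr co_norm0 big_ord0.
rewrite big_ord_recr/= addnS -(subrK (g (k + m)%N) (g k)) -addrA.
by rewrite (le_trans (co_normD _ _ pG))// lerD.
Qed.

Lemma contra_norm_steps_le k m :
  contra_norm G (invmx (g k) - invmx (g (k + m)%N)) <= \sum_(j < m) d (k + j)%N.
Proof.
have pI := posdef_inv pG; rewrite contra_normE.
elim: m => [|m IH]; first by rewrite addn0 subrr co_norm0 big_ord0.
rewrite big_ord_recr/= addnS -(subrK (invmx (g (k + m)%N)) (invmx (g k))) -addrA.
by rewrite (le_trans (co_normD _ _ pI))// lerD// -contra_normE.
Qed.

Let C : R := contra_norm G (invmx (g 0)) + B + 1.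

Let B_ge0 : 0 <= B. Proof. by have := sum_d 0; rewrite big_ord0. Qed.

Let C_gt0 : 0 < C.
Proof. by rewrite ltr_wpDl// addr_ge0// contra_normE co_norm_ge0. Qed.

(** The inverses stay bounded, so the metrics stay bounded below. *)
Lemma loewner_le_seq k : loewner_le G (C *: g k).
Proof.
have pI := posdef_inv pG.
have Ck : contra_norm G (invmx (g k)) <= C.
  have := contra_norm_steps_le 0 k; rewrite !contra_normE add0n => h.
  rewrite -[invmx (g k)](subrK (invmx (g 0))) addrC.
  rewrite (le_trans (co_normD _ _ pI))// /C -addrA contra_normE lerD2l.
  rewrite -opprB co_normN (le_trans h)// (le_trans (sum_d k))//.
  by rewrite lerDl.
have IC : loewner_le (invmx (g k)) (C *: invmx G).
  move=> v; rewrite qformZ (le_trans (ler_norm _))//.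
  apply: (le_trans (qform_le_co_norm _ _ pI)).
  by rewrite ler_wpM2r ?posdef_qform_ge0// -contra_normE.
have := loewner_le_inv (posdef_inv (pg k)) pI (ltW C_gt0) IC.
by rewrite !invmxK.
Qed.

Lemma qform_mx_lim v : qform (g k) v @[k --> \oo] --> qform mx_lim v.
Proof. exact: (@cvg_mulmx_entry R _ _ _ _ _ _ _ v v^T g mx_lim 0 0 mx_limP). Qed.

Lemma loewner_le_mx_lim : loewner_le G (C *: mx_lim).
Proof.
move=> v; rewrite qformZ.
apply: (@cvgr_to_ge _ _ eventually_filter _ (fun k => C * qform (g k) v)).
  by apply: cvgMl_tmp; exact: qform_mx_lim.
by apply: nearW => k; rewrite -qformZ; exact: loewner_le_seq.
Qed.

Lemma posdef_mx_lim : posdef mx_lim.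
Proof.
split.
  apply/matrixP => a b; rewrite [LHS]mxE.
  have h : g k a b @[k --> \oo] --> mx_lim b a.
    have h := @mx_limP b a; apply: cvg_near_eq h; apply: nearW => k.
    by have [sg _] := pg k; rewrite -[in LHS]sg mxE.
  by apply: (cvg_unique _ h (@mx_limP a b)).
move=> v v0; rewrite -(pmulr_rgt0 _ C_gt0).
rewrite -/(qform mx_lim v) -qformZ.
by apply: lt_le_trans (loewner_le_mx_lim v); have [_] := pG; exact.
Qed.

Lemma co_norm_mx_lim_le k b : (forall m, \sum_(j < m) d (k + j)%N <= b) ->
  co_norm G (g k - mx_lim) <= b.
Proof.
move=> db; apply: (@cvgr_to_le _ _ eventually_filter _
    (fun m => co_norm G (g k - g (m + k)%N))).
  apply: cvg_co_norm => a c; rewrite mx_subE.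
  have h : g k a c - g (m + k)%N a c @[m --> \oo] --> g k a c - mx_lim a c.
    apply: cvgB; first exact: cvg_cst.
    by rewrite (cvg_shiftn k (fun m => g m a c)); exact: mx_limP.
  by apply: cvg_near_eq h; apply: nearW => m; rewrite mx_subE.
by apply: nearW => m; rewrite addnC (le_trans (co_norm_steps_le _ _)).
Qed.

(** Inverses of metrics with a common lower bound depend continuously on them, so
    the bound on finite sums of steps passes to the limit. *)
Lemma contra_norm_mx_lim_le k b : (forall m, \sum_(j < m) d (k + j)%N <= b) ->
  contra_norm G (invmx (g k) - invmx mx_lim) <= b.
Proof.
move=> db; pose e m := co_norm G (g (k + m)%N - mx_lim).
apply: (@cvgr_to_ge _ _ eventually_filter _ (fun m => b + C * C * e m)).
  rewrite -[X in _ --> X]addr0 -[X in _ --> _ + X](mulr0 (C * C)).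
  apply: cvgD; first exact: cvg_cst.
  apply: cvgMl_tmp; rewrite -(co_norm0 G) -(subrr mx_lim).
  apply: cvg_co_norm => a c; rewrite mx_subE.
  have h : g (m + k)%N a c - mx_lim a c @[m --> \oo] --> mx_lim a c - mx_lim a c.
    apply: cvgB; last exact: cvg_cst.
    by rewrite (cvg_shiftn k (fun m => g m a c)); exact: mx_limP.
  by apply: cvg_near_eq h; apply: nearW => m; rewrite addnC mx_subE.
apply: nearW => m.
rewrite -(subrK (invmx (g (k + m)%N)) (invmx (g k))) -addrA contra_normE.
rewrite (le_trans (co_normD _ _ (posdef_inv pG)))// lerD// -contra_normE.
  exact: le_trans (contra_norm_steps_le _ _) (db m).
apply: contra_norm_inv_sub_le => //.
- exact: posdef_mx_lim.
- exact: loewner_le_seq.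
- exact: loewner_le_mx_lim.
Qed.

End SequencesOfInnerProducts.

(** * The initial value *)

Section InitialValue.
Context {R : realType} {n : nat} {M : ptopologicalType}.
Variable X : smooth_manifold R n M.
Variables (T : R) (l : R -> components X).
Hypothesis rf : ricci_flow T l.
Variable al : R.
Hypotheses (T0 : 0 < T) (al0 : 0 < al).
Hypothesis ricci_le : forall t, 0 < t <= T -> forall x : M,
  co_norm_at (l t) (ricci (l t)) x <= al / t.
Variable vol : R -> {measure set (borel M) -> \bar R}.
Hypothesis volE : forall t, 0 < t <= T -> volume_measure (l t) (vol t).
Hypothesis ricci_int : forall t, 0 < t <= T ->
  (\int[vol t]_x (co_norm_at (l t) (ricci (l t)) x)%:E <= al%:E)%E.
Variable p : R.
Hypothesis p1 : 1 <= p.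

Let p0 : 0 < p. Proof. exact: lt_le_trans p1. Qed.

Let TT : 0 < T <= T. Proof. by rewrite T0 lexx. Qed.

Lemma measurable_co_norm_sub t (g h : components X) : 0 < t <= T ->
  covariant2 g -> covariant2 h -> measurable_components g -> measurable_components h ->
  measurable_fun (setT : set (borel M)) (co_norm_at (l t) (sub_tensor g h) : borel M -> R).
Proof.
move=> tT cg ch mg mh.
apply: (measurable_co_norm_at (flow_posdef rf tT) (flow_transforms rf tT)).
- move=> i j x xi xj; rewrite /sub_tensor (cg i j x xi xj) (ch i j x xi xj).
  by rewrite mulmxBr mulmxBl.
- exact: (flow_measurable rf tT).
- move=> i; apply: (measurable_mxB (D := dom X i : set (borel M))).
    exact: mg.
  exact: mh.
Qed.

Lemma measurable_contra_norm_sub t (g h : components X) : 0 < t <= T ->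
  covariant2 g -> covariant2 h -> measurable_components g -> measurable_components h ->
  (forall i x, dom X i x -> posdef (g i x)) ->
  (forall i x, dom X i x -> posdef (h i x)) ->
  measurable_fun (setT : set (borel M))
    (contra_norm_at (l t) (sub_tensor (inv_tensor g) (inv_tensor h)) : borel M -> R).
Proof.
move=> tT cg ch mg mh pg ph.
have mi (f : components X) : measurable_components f ->
    (forall i x, dom X i x -> posdef (f i x)) -> measurable_components (inv_tensor f).
  move=> mf pf i.
  by apply: (measurable_invmx (D := dom X i : set (borel M))); [exact: pf|exact: mf].
have -> : contra_norm_at (l t) (sub_tensor (inv_tensor g) (inv_tensor h)) =
    co_norm_at (inv_tensor (l t)) (sub_tensor (inv_tensor g) (inv_tensor h)).
  by apply/funext => x; exact: contra_normE.
have pt := flow_posdef rf tT.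
apply: (measurable_co_norm_at (P := @inverse_cocycle R n M X)).
- by move=> i x xi; apply: posdef_inv; exact: pt.
- exact: (transforms_inv pt (flow_transforms rf tT)).
- move=> i j x xi xj; rewrite /sub_tensor (transforms_inv pg cg xi xj).
  by rewrite (transforms_inv ph ch xi xj) mulmxBr mulmxBl.
- by apply: mi => //; exact: (flow_measurable rf tT).
- move=> i; apply: (measurable_mxB (D := dom X i : set (borel M))).
    exact: (mi _ mg pg).
  exact: (mi _ mh ph).
Qed.

(** The distance of two initial values is at most the sum of their distances to the
    metric at time [s], for every [s]. *)
Lemma Lp_initial_value_unique t h h' : 0 < t <= T ->
  Lp_initial_value p l (l t) (vol t) h -> Lp_initial_value p l (l t) (vol t) h' ->
  {ae vol t, forall x, h (chart_at X x) x = h' (chart_at X x) x}.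
Proof.
move=> tT [[ch mh] _ _ cvh _] [[ch' mh'] _ _ cvh' _].
have pt x : posdef (l t (chart_at X x) x).
  exact: (flow_posdef rf tT (dom_chart_at X x)).
pose u : borel M -> R := co_norm_at (l t) (sub_tensor h h').
have mu : measurable_fun setT u by exact: measurable_co_norm_sub.
have N0 : ('N[vol t]_p%:E[EFin \o u] = 0)%E.
  apply/eqP; rewrite eq_le Lnorm_ge0 andbT.
  have sum0 : ('N[vol t]_p%:E[EFin \o co_norm_at (l t) (sub_tensor (l s) h)] +
      'N[vol t]_p%:E[EFin \o co_norm_at (l t) (sub_tensor (l s) h')])%E
      @[s --> 0^'+] --> (0 + 0)%E by apply: cvgeD.
  rewrite -[leRHS]adde0; apply: (cvge_to_ge sum0).
  near=> s; have sT : 0 < s <= T.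
    apply/andP; split; near: s; first exact: nbhs_right_gt.
    exact: nbhs_right_le.
  have ms g : covariant2 g -> measurable_components g ->
      measurable_fun (setT : set (borel M)) (co_norm_at (l t) (sub_tensor (l s) g) : borel M -> R).
    move=> cg mg; apply: measurable_co_norm_sub => //.
      exact: (flow_transforms rf sT).
    exact: (flow_measurable rf sT).
  apply: le_trans (minkowski_EFin _ (ms h ch mh) (ms h' ch' mh') p1).
  rewrite -[leRHS]mul1e; apply: Lnorm_le_mul => // x.
  rewrite co_norm_at_ge0 mul1r/= /co_norm_at /sub_tensor.
  rewrite /u /co_norm_at /sub_tensor.
  move: (l s _ x) (h _ x) (h' _ x) => a b b'.
  have -> : b - b' = - (a - b) + (a - b') by rewrite opprB addrA subrK.
  by rewrite (le_trans (co_normD _ _ (pt x)))// co_normN.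
have ae0 := Lnorm_eq0_eq0 (_ : measurable_fun setT (EFin \o u)) (_ : (0 < p%:E)%E) N0.
have : {ae vol t, forall x, setT x -> (u x)%:E = 0%E}.
  by apply: ae0; [exact/measurable_EFinP|rewrite lte_fin].
apply: filterS => x /(_ I) [] ux.
by apply/eqP; rewrite -subr_eq0; apply/eqP; exact: co_norm_eq0 ux.
Unshelve. all: by end_near. Qed.

(** Norms and volumes at two positive times are comparable, so having an L^p
    initial value does not depend on the reference time. *)
Lemma Lp_initial_value_transfer t h : 0 < t <= T ->
  Lp_initial_value p l (l T) (vol T) h -> Lp_initial_value p l (l t) (vol t) h.
Proof.
move=> /andP[t0 tT] [mh ph fh ch cih].
pose c := (T / t) `^ (2 * al); pose v := (T / t) `^ (al * n%:R).
have c0 : 0 < c by rewrite powR_gt0// divr_gt0.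
have v0 : 0 <= v by exact: powR_ge0.
have volle A : measurable A -> (vol t A <= v%:E * vol T A)%E /\ (vol T A <= v%:E * vol t A)%E.
  exact: (flow_volume_le rf ricci_le volE t0 tT (lexx T)).
have volT A : measurable A -> (vol t A <= v%:E * vol T A)%E by move=> /volle[].
have tT' : 0 < t <= T by rewrite t0.
have pt := flow_posdef rf tT'; have pT := flow_posdef rf TT.
have cole A x : 0 <= co_norm_at (l t) A x <= c * co_norm_at (l T) A x.
  have xc := dom_chart_at X x.
  rewrite co_norm_at_ge0/=; apply: co_norm_loewner_le => //; first exact: pT.
    exact: pt.
  by have [] := flow_loewner rf ricci_le xc t0 tT (lexx T).
have contrale A x : 0 <= contra_norm_at (l t) A x <= c * contra_norm_at (l T) A x.
  have xc := dom_chart_at X x.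
  rewrite {1}/contra_norm_at contra_normE co_norm_ge0/=.
  apply: contra_norm_loewner_le => //; first exact: pt.
    exact: pT.
  by have [] := flow_loewner rf ricci_le xc t0 tT (lexx T).
have cvg0 (f f' : R -> borel M -> R) : (forall s x, 0 <= f s x <= c * f' s x) ->
    'N[vol T]_p%:E[EFin \o f' s]%E @[s --> 0^'+] --> 0%E ->
    'N[vol t]_p%:E[EFin \o f s]%E @[s --> 0^'+] --> 0%E.
  move=> ff' f'0; pose C := (v * c `^ p) `^ p^-1.
  apply: (@squeeze_cvge _ _ _ _ (cst 0%E) _ (fun s => C%:E * 'N[vol T]_p%:E[EFin \o f' s])%E).
  - by apply: nearW => s; rewrite Lnorm_ge0/=; exact: Lnorm_le_scale.
  - exact: cvg_cst.
  - by rewrite -(mule0 C%:E); apply: cvgeZl.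
split => //.
- have [N [mN N0 phN]] := ph; exists N; split => //.
  apply/eqP; rewrite eq_le measure_ge0 andbT (le_trans (volT N mN))//.
  by rewrite N0 mule0.
- move=> A mA Afin.
  have : finite_norm (vol T) p%:E (co_norm_at (l T) h \_ A : borel M -> R).
    apply: fh => //; have [_ /le_lt_trans] := volle A mA; apply.
    by rewrite lte_mul_pinfty// lee_fin.
  rewrite /finite_norm => fin.
  apply: (@le_lt_trans _ _ (((v * c `^ p) `^ p^-1)%:E *
      'N[vol T]_p%:E[EFin \o (co_norm_at (l T) h \_ A : borel M -> R)])%E).
    apply: Lnorm_le_scale => // x; rewrite !patchE; case: ifP => // _.
    by rewrite mulr0 lexx.
  by rewrite lte_mul_pinfty// lee_fin powR_ge0.
- by apply: cvg0 ch => s x; exact: cole.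
- by apply: cvg0 cih => s x; exact: contrale.
Qed.

Hypothesis alE : al * (6 * p + n%:R) = 2^-1.

(* [z ^+ 2] is the factor [4 `^ - (2 p)^-1] that the deviation bound gains at each
   quarter time; its square root is what the summation of the steps uses. *)
Let z : R := 2^-1 `^ (2 * p)^-1.

Let z_itv : 0 < z < 1.
Proof.
rewrite powR_gt0//= /z -[X in _ < X](_ : 1 `^ (2 * p)^-1 = 1); last by rewrite powR1.
by rewrite gt0_ltr_powR ?invr_gt0 ?mulr_gt0// ?nnegrE// invf_lt1// ltr1n.
Qed.

Definition quarter_time (k : nat) : R := T / 4 ^+ k.

Local Notation sk := quarter_time.

Lemma quarter_timeS k : sk k = 4 * sk k.+1.
Proof. by rewrite /quarter_time exprS; field; rewrite expf_neq0. Qed.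

Lemma quarter_time_gt0 k : 0 < sk k.
Proof. by rewrite divr_gt0// exprn_gt0. Qed.

Lemma quarter_time_le k m : (k <= m)%N -> sk m <= sk k.
Proof.
move=> km; rewrite /quarter_time ler_wpM2l ?(ltW T0)// lef_pV2 ?posrE ?exprn_gt0//.
by rewrite ler_weXn2l// ler1n.
Qed.

Lemma quarter_time_itv k : 0 < sk k <= T.
Proof.
rewrite quarter_time_gt0/= (le_trans (quarter_time_le (leq0n k)))//.
by rewrite /quarter_time expr0 divr1.
Qed.

Lemma quarter_time_locate s : 0 < s <= T ->
  exists k, sk k.+1 <= s /\ s <= sk k.
Proof.
move=> /andP[s0 sT].
have ex : exists k, sk k.+1 <= s.
  exists (Num.trunc (T / s)); rewrite /quarter_time.
  rewrite ler_pdivrMr ?exprn_gt0// mulrC -ler_pdivrMr//.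
  rewrite (le_trans (ltW (truncnS_gt _)))// -natrX ler_nat.
  by rewrite ltnW// ltn_expl.
exists (ex_minn ex); case: ex_minnP => -[|k] h min; split=> //.
  by rewrite /quarter_time expr0 divr1.
by rewrite leNgt; apply/negP => /ltW /min; rewrite ltnn.
Qed.

Lemma quarter_deviation_Lnorm_le k s : sk k.+1 <= s -> s <= sk k ->
  ('N[vol T]_p%:E[EFin \o deviation T l al (sk k.+1) s]
     <= (deviation_bound T al p * z ^+ k.*2)%:E)%E.
Proof.
move=> ks sk'; have /andP[_ kT] := quarter_time_itv k.
apply: (le_trans (deviation_Lnorm_le rf T0 al0 ricci_le volE ricci_int p1 alE
  (quarter_time_gt0 k.+1) ks _ (le_trans sk' kT))).
  by rewrite -quarter_timeS.
rewrite lee_fin ler_wpM2l ?deviation_bound_ge0//.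
have -> : z ^+ k.*2 = (2^-1 ^+ k.*2) `^ (2 * p)^-1.
  by rewrite /z -!powR_mulrn ?powR_ge0 ?invr_ge0// powRAC.
have -> : sk k.+1 / T = (4 ^+ k.+1)^-1.
  by rewrite /quarter_time mulrAC divff ?gt_eqF// mul1r.
rewrite ge0_ler_powR ?nnegrE ?invr_ge0 ?mulr_ge0 ?(ltW p0) ?exprn_ge0 ?invr_ge0//.
rewrite -mul2n exprM exprVn (_ : (2 : R) ^+ 2 = 4); last by rewrite -natrX.
by rewrite exprVn lef_pV2 ?posrE ?exprn_gt0// ler_weXn2l// ler1n.
Qed.

Let step k (x : borel M) : R := deviation T l al (sk k.+1) (sk k) x.

Let step_co k x :
  co_norm_at (l T) (sub_tensor (l (sk k)) (l (sk k.+1))) x <= step k x.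
Proof.
have /andP[_ kT] := quarter_time_itv k.
apply: co_norm_le_deviation => //; first exact: quarter_time_gt0.
exact: quarter_time_le.
Qed.

Let step_contra k x : contra_norm_at (l T)
  (sub_tensor (inv_tensor (l (sk k))) (inv_tensor (l (sk k.+1)))) x <= step k x.
Proof.
have /andP[_ kT] := quarter_time_itv k.
apply: (contra_norm_le_deviation rf) => //; first exact: quarter_time_gt0.
exact: quarter_time_le.
Qed.

Let tail_bound : R := deviation_bound T al p / (1 - z) ^+ 2.

(** One majorant of all the partial sums gives both the pointwise limit and, through
    its small norm, the rate of convergence. *)
Lemma quarter_step_majorant k : exists (N : set (borel M)) (V : borel M -> R),
  [/\ measurable N /\ vol T N = 0%E,
      measurable_fun setT V, (forall x, 0 <= V x),
      ('N[vol T]_p%:E[EFin \o V] <= (tail_bound * z ^+ k.*2)%:E)%E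
    & forall x, ~ N x -> forall m, \sum_(j < m) step (k + j) x <= V x].
Proof.
have /andP[z0 _] := z_itv.
have [||||N [V [? ? ? VN ?]]] := @Lnorm_series_majorant _ (borel M) R (vol T) p
  (deviation_bound T al p * z ^+ k.*2) z (fun j => step (k + j)) p1 _ z_itv.
- by rewrite mulr_ge0 ?deviation_bound_ge0// exprn_ge0// ltW.
- by move=> j; apply: (deviation_measurable rf al T0); exact: quarter_time_itv.
- by move=> j x; rewrite /step; exact: deviation_ge0.
- move=> j; rewrite -mulrA -exprD -doubleD.
  by apply: quarter_deviation_Lnorm_le => //; exact: quarter_time_le.
exists N, V; split => //.
by rewrite /tail_bound mulrAC.
Qed.

Let Nbad k : set (borel M) := sval (cid (quarter_step_majorant k)).
Let Vmaj k : borel M -> R := sval (cid (svalP (cid (quarter_step_majorant k)))).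
Let majP k := svalP (cid (svalP (cid (quarter_step_majorant k)))).

(** The limit along the quarter times; on the null set where the steps need not
    be summable it is given the value of a fixed metric, so as to be a positive
    definite tensor everywhere. *)
Definition initial_tensor : components X := fun i x =>
  if x \in Nbad 0 then l T i x else mx_lim (fun k => l (sk k) i x).

Section Pointwise.
Variables (i : chart X) (x : M).
Hypotheses (xi : dom X i x) (xN : ~ Nbad 0 x).

Let pT := flow_posdef rf TT xi.
Let pk k := flow_posdef rf (quarter_time_itv k) xi.

Let co_chart k : co_norm (l T i x) (l (sk k) i x - l (sk k.+1) i x) <= step k x.
Proof.
apply: le_trans (step_co k x).
rewrite (co_norm_at_chart (flow_posdef rf TT) (flow_transforms rf TT) _ xi)//.
move=> a b y ya yb; rewrite /sub_tensor.
rewrite (flow_transforms rf (quarter_time_itv k) ya yb).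
by rewrite (flow_transforms rf (quarter_time_itv k.+1) ya yb) mulmxBr mulmxBl.
Qed.

Let sum_step m : \sum_(j < m) step j x <= Vmaj 0 x.
Proof. by have [_ _ _ _ /(_ x xN m)] := majP 0. Qed.

Lemma cvg_initial_tensor a b : l (sk k) i x a b @[k --> \oo] --> initial_tensor i x a b.
Proof.
rewrite /initial_tensor memNset//.
exact: (mx_limP pT co_chart sum_step).
Qed.

End Pointwise.

Section AtChart.
Variable x : M.
Hypothesis xN : ~ Nbad 0 x.

Let i := chart_at X x.
Let xi : dom X i x := dom_chart_at X x.
Let pT := flow_posdef rf TT xi.
Let pk k := flow_posdef rf (quarter_time_itv k) xi.

Let sum_step m : \sum_(j < m) step j x <= Vmaj 0 x.
Proof. by have [_ _ _ _ /(_ x xN m)] := majP 0. Qed.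

Lemma posdef_initial_tensor_at : posdef (initial_tensor i x).
Proof.
rewrite /initial_tensor memNset//.
exact: (posdef_mx_lim pT pk (step_co^~ x) (step_contra^~ x) sum_step).
Qed.

Lemma initial_tensor_co_le k : ~ Nbad k x ->
  co_norm_at (l T) (sub_tensor (l (sk k)) initial_tensor) x <= Vmaj k x.
Proof.
move=> kN; rewrite /co_norm_at /sub_tensor /initial_tensor memNset//.
apply: (co_norm_mx_lim_le pT (step_co^~ x) sum_step (k := k)) => m.
by have [_ _ _ _ /(_ x kN m)] := majP k.
Qed.

Lemma initial_tensor_contra_le k : ~ Nbad k x ->
  contra_norm_at (l T) (sub_tensor (inv_tensor (l (sk k))) (inv_tensor initial_tensor)) x
    <= Vmaj k x.
Proof.
move=> kN; rewrite /contra_norm_at /sub_tensor /inv_tensor /initial_tensor memNset//.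
apply: (contra_norm_mx_lim_le pT pk (step_co^~ x) (step_contra^~ x) sum_step (k := k)) => m.
by have [_ _ _ _ /(_ x kN m)] := majP k.
Qed.

End AtChart.

Lemma initial_tensor_covariant : covariant2 initial_tensor.
Proof.
move=> i j x xi xj; have [xN|xN] := pselect (Nbad 0 x).
  by rewrite /initial_tensor mem_set//; exact: (flow_transforms rf TT xi xj).
set J := 'J _ _; apply/matrixP => a b.
have h := @cvg_mulmx_entry R _ _ _ _ _ _ _ J J^T (fun k => l (sk k) j x)
  (initial_tensor j x) a b (fun c d => @cvg_initial_tensor j x xj xN c d).
have h' := @cvg_initial_tensor i x xi xN a b.
apply: (cvg_unique _ h') => //.
apply: cvg_near_eq (h _); apply: nearW => k.
by rewrite (flow_transforms rf (quarter_time_itv k) xi xj).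
Qed.

(** The steps are bounded at [x] in the distinguished chart around it; covariance
    carries positivity over to the other charts. *)
Lemma initial_tensor_posdef i x : dom X i x -> posdef (initial_tensor i x).
Proof.
move=> xi; have [xN|xN] := pselect (Nbad 0 x).
  by rewrite /initial_tensor mem_set//; exact: (flow_posdef rf TT xi).
have xc := dom_chart_at X x; have pc := posdef_initial_tensor_at xN.
have uJ : jacobian_cocycle i (chart_at X x) x \in unitmx.
  exact: (transforms_unit (flow_posdef rf TT) (flow_transforms rf TT)).
have [P [_ uP E]] := posdef_cholesky pc.
rewrite (initial_tensor_covariant xi xc) E -/(jacobian_cocycle i (chart_at X x) x).
rewrite mulmxA -mulmxA -trmx_mul; apply: mul_tr_posdef.
by rewrite unitmx_mul uJ.
Qed.

Lemma initial_tensor_measurable : measurable_components initial_tensor.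
Proof.
move=> i a b; have [[mN _] _ _ _ _] := majP 0.
pose f k (x : borel M) : R := (\1_(Nbad 0) x * l T i x a b +
  (1 - \1_(Nbad 0) x) * l (sk k) i x a b).
apply: (@measurable_fun_cvg _ _ _ _ f).
  move=> k; have mI : measurable_fun (dom X i : set (borel M)) (\1_(Nbad 0) : borel M -> R).
    exact: measurable_indic.
  apply: measurable_funD; apply: measurable_funM => //.
  - exact: (flow_measurable rf TT).
  - by apply: measurable_funB => //; exact: measurable_cst.
  - exact: (flow_measurable rf (quarter_time_itv k)).
move=> x xi; rewrite /f; have [xN|xN] := pselect (Nbad 0 x).
  rewrite /initial_tensor indicE mem_set//=.
  under eq_fun do rewrite mul1r subrr mul0r addr0.
  exact: cvg_cst.
under eq_fun do rewrite indicE memNset//= mul0r add0r subr0 mul1r.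
exact: cvg_initial_tensor.
Qed.

Let ae_good k : {ae vol T, forall x, ~ Nbad 0 x /\ ~ Nbad k x}.
Proof.
have nN m : (vol T).-negligible (Nbad m).
  by have [[mN N0] _ _ _ _] := majP m; exists (Nbad m); split.
have := negligibleU (nN 0) (nN k); apply: negligibleS => x /= h.
by apply: contrapT => /not_orP.
Qed.

Lemma initial_tensor_quarter_le k :
  ('N[vol T]_p%:E[EFin \o co_norm_at (l T) (sub_tensor (l (sk k)) initial_tensor)]
     <= (tail_bound * z ^+ k.*2)%:E)%E /\
  ('N[vol T]_p%:E[EFin \o contra_norm_at (l T)
      (sub_tensor (inv_tensor (l (sk k))) (inv_tensor initial_tensor))]
     <= (tail_bound * z ^+ k.*2)%:E)%E.
Proof.
have [_ mV _ VN _] := majP k; have kT := quarter_time_itv k.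
split; apply: (le_trans _ VN); apply: Lnorm_ae_le => //.
- apply: measurable_co_norm_sub => //.
  + exact: (flow_transforms rf kT).
  + exact: initial_tensor_covariant.
  + exact: (flow_measurable rf kT).
  + exact: initial_tensor_measurable.
- apply: filterS (ae_good k) => x [x0 xk]; rewrite co_norm_at_ge0/=.
  exact: initial_tensor_co_le.
- apply: measurable_contra_norm_sub => //.
  + exact: (flow_transforms rf kT).
  + exact: initial_tensor_covariant.
  + exact: (flow_measurable rf kT).
  + exact: initial_tensor_measurable.
  + exact: (flow_posdef rf kT).
  + exact: initial_tensor_posdef.
- apply: filterS (ae_good k) => x [x0 xk]; rewrite {1}/contra_norm_at contra_normE co_norm_ge0/=.
  exact: initial_tensor_contra_le.
Qed.

Let rate k : R := (deviation_bound T al p + tail_bound) * z ^+ k.*2.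

(** Between two quarter times the metric stays close to the earlier one of them. *)
Lemma initial_tensor_Lnorm_le k s : sk k.+1 <= s -> s <= sk k ->
  ('N[vol T]_p%:E[EFin \o co_norm_at (l T) (sub_tensor (l s) initial_tensor)]
     <= (rate k)%:E)%E /\
  ('N[vol T]_p%:E[EFin \o contra_norm_at (l T)
      (sub_tensor (inv_tensor (l s)) (inv_tensor initial_tensor))]
     <= (rate k)%:E)%E.
Proof.
move=> ks sk'; have /andP[z0 z1] := z_itv.
have k0 := quarter_time_gt0 k.+1.
have s0 := lt_le_trans k0 ks.
have sT : s <= T by have /andP[_] := quarter_time_itv k; exact: le_trans.
have sT' : 0 < s <= T by rewrite s0.
have kT := quarter_time_itv k.+1.
have dN := quarter_deviation_Lnorm_le ks sk'.
have mD : measurable_fun (setT : set (borel M))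
    (deviation T l al (sk k.+1) s : borel M -> R).
  exact: (deviation_measurable rf al T0).
have [coN ciN] := initial_tensor_quarter_le k.+1.
have tb0 : 0 <= tail_bound.
  by rewrite divr_ge0 ?deviation_bound_ge0// exprn_ge0// subr_ge0 ltW.
have rateE : ((deviation_bound T al p * z ^+ k.*2)%:E +
    (tail_bound * z ^+ k.+1.*2)%:E <= (rate k)%:E)%E.
  rewrite -EFinD lee_fin /rate mulrDl lerD2l ler_wpM2l//.
  by rewrite ler_wiXn2l ?(ltW z0) ?(ltW z1)// leq_double.
have pT x : posdef (l T (chart_at X x) x).
  exact: (flow_posdef rf TT (dom_chart_at X x)).
have main (f g : borel M -> R) : measurable_fun setT g ->
    (forall x, 0 <= f x <= deviation T l al (sk k.+1) s x + g x) ->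
    ('N[vol T]_p%:E[EFin \o g] <= (tail_bound * z ^+ k.+1.*2)%:E)%E ->
    ('N[vol T]_p%:E[EFin \o f] <= (rate k)%:E)%E.
  move=> mg fg gN.
  have h := minkowski_EFin (vol T) mD mg p1.
  apply: le_trans rateE; apply: le_trans (leeD dN gN); apply: le_trans h.
  rewrite -[leRHS]mul1e; apply: Lnorm_le_mul => // x; rewrite mul1r.
  exact: fg.
split.
- apply: main coN.
    apply: measurable_co_norm_sub => //.
    + exact: (flow_transforms rf kT).
    + exact: initial_tensor_covariant.
    + exact: (flow_measurable rf kT).
    + exact: initial_tensor_measurable.
  move=> x; rewrite co_norm_at_ge0/=.
  apply: (@le_trans _ _ (co_norm_at (l T) (sub_tensor (l s) (l (sk k.+1))) x +
      co_norm_at (l T) (sub_tensor (l (sk k.+1)) initial_tensor) x)).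
    rewrite /co_norm_at /sub_tensor.
    move: (l s _ x) (l (sk _) _ x) (initial_tensor _ x) => a b c.
    by rewrite (le_trans _ (co_normD _ _ (pT x)))// addrA subrK.
  by rewrite lerD2r; apply: co_norm_le_deviation.
- apply: main ciN.
    apply: measurable_contra_norm_sub => //.
    + exact: (flow_transforms rf kT).
    + exact: initial_tensor_covariant.
    + exact: (flow_measurable rf kT).
    + exact: initial_tensor_measurable.
    + exact: (flow_posdef rf kT).
    + exact: initial_tensor_posdef.
  move=> x; rewrite {1}/contra_norm_at contra_normE co_norm_ge0/=.
  apply: (@le_trans _ _ (contra_norm_at (l T)
        (sub_tensor (inv_tensor (l s)) (inv_tensor (l (sk k.+1)))) x +
      contra_norm_at (l T)
        (sub_tensor (inv_tensor (l (sk k.+1))) (inv_tensor initial_tensor)) x)).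
    rewrite /contra_norm_at /sub_tensor !contra_normE.
    move: (inv_tensor (l s) _ x) (inv_tensor (l (sk _)) _ x) (inv_tensor initial_tensor _ x) => a b c.
    by rewrite (le_trans _ (co_normD _ _ (posdef_inv (pT x))))// addrA subrK.
  by rewrite lerD2r; apply: (contra_norm_le_deviation rf).
Qed.

Lemma initial_tensor_Lp : Lp_initial_value p l (l T) (vol T) initial_tensor.
Proof.
have /andP[z0 z1] := z_itv.
have tb0 : 0 <= tail_bound.
  by rewrite divr_ge0 ?deviation_bound_ge0// exprn_ge0// subr_ge0 ltW.
have ev (f : R -> borel M -> R) :
    (forall k s, sk k.+1 <= s -> s <= sk k ->
      ('N[vol T]_p%:E[EFin \o f s] <= (rate k)%:E)%E) ->
    'N[vol T]_p%:E[EFin \o f s]%E @[s --> 0^'+] --> 0%E.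
  move=> fk; apply: Lnorm_cvg0 => e e0.
  have [K Ke] : exists K, rate K <= e.
    pose c := deviation_bound T al p + tail_bound.
    have c0 : 0 <= c by rewrite addr_ge0 ?deviation_bound_ge0.
    have c1 : 0 < c + 1 by rewrite ltr_wpDl.
    have zc : GRing.exp z k @[k --> \oo] --> (0 : R).
      by apply: cvg_expr; rewrite ger0_norm ?ltW.
    have /cvgrPdist_lt/(_ _ (divr_gt0 e0 c1)) [K _ /(_ K (leqnn K))] := zc.
    rewrite /= sub0r normrN ger0_norm ?exprn_ge0 ?(ltW z0)// => zK.
    exists K; rewrite /rate -/c; apply: (@le_trans _ _ ((c + 1) * z ^+ K)).
      apply: ler_pM; rewrite ?exprn_ge0 ?(ltW z0)// ?lerDl//.
      by rewrite ler_wiXn2l ?(ltW z0) ?(ltW z1)// -addnn leq_addr.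
    by rewrite mulrC -ler_pdivlMr// ltW.
  near=> s.
  have sT : 0 < s <= T.
    apply/andP; split; near: s; first exact: nbhs_right_gt.
    exact: nbhs_right_le.
  have sK : s < sk K.
    by near: s; apply: nbhs_right_lt; exact: quarter_time_gt0.
  have [k [ks sk']] := quarter_time_locate sT.
  apply: (le_trans (fk k s ks sk')); rewrite lee_fin; apply: le_trans Ke.
  have Kk : (K <= k)%N.
    rewrite leqNgt; apply/negP => kK.
    by have := lt_le_trans sK (le_trans (quarter_time_le kK) ks); rewrite ltxx.
  rewrite /rate ler_wpM2l ?addr_ge0 ?deviation_bound_ge0//.
  by rewrite ler_wiXn2l ?(ltW z0) ?(ltW z1)// leq_double.
split.
- by split; [exact: initial_tensor_covariant|exact: initial_tensor_measurable].
- apply: filterS (ae_good 0) => x _.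
  by apply: initial_tensor_posdef; exact: dom_chart_at.
(* [l T] has constant norm with respect to itself, hence is in L^p on sets of finite
   volume, and it differs from [initial_tensor] by a tensor of finite p-norm. *)
- move=> A mA Afin.
  have sk0 : sk 0 = T by rewrite /quarter_time expr0 divr1.
  have [dN _] := initial_tensor_quarter_le 0; rewrite sk0 in dN.
  pose g (x : borel M) : R := Num.sqrt n%:R * \1_A x.
  have g0 x : 0 <= g x by rewrite mulr_ge0 ?sqrtr_ge0// indicE.
  have mg : measurable_fun setT g.
    by apply: measurable_funM; [exact: measurable_cst|exact: measurable_indic].
  have gN : ('N[vol T]_p%:E[EFin \o g] < +oo)%E.
    rewrite Lnorm_EFinE; apply: poweR_lty.
    apply: (@le_lt_trans _ _ (((Num.sqrt n%:R) `^ p)%:E * vol T A)%E); last first.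
      by rewrite lte_mul_pinfty// lee_fin powR_ge0.
    rewrite -(setIT A) -(integral_indic _ measurableT mA) -ge0_integralZl_EFin ?powR_ge0//; last first.
      by apply/measurable_EFinP; exact: measurable_indic.
    apply: ge0_le_integral_nonmeasurable => x; first by rewrite lee_fin powR_ge0.
    rewrite ger0_norm// /g -EFinM lee_fin indicE; case: (x \in A).
      by rewrite !mulr1.
    by rewrite !mulr0 powR0// gt_eqF.
  have md : measurable_fun (setT : set (borel M))
      (co_norm_at (l T) (sub_tensor (l T) initial_tensor) : borel M -> R).
    apply: measurable_co_norm_sub => //.
    + exact: (flow_transforms rf TT).
    + exact: initial_tensor_covariant.
    + exact: (flow_measurable rf TT).
    + exact: initial_tensor_measurable.
  rewrite /finite_norm; have h := minkowski_EFin (vol T) md mg p1.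
  apply: le_lt_trans (_ : _ < +oo)%E; last first.
    by apply: le_lt_trans h _; rewrite lte_add_pinfty// (le_lt_trans dN) ?ltry.
  rewrite -[leRHS]mul1e; apply: Lnorm_le_mul => // x; rewrite mul1r patchE /= /g indicE.
  case: ifPn => [xA|_]; last by rewrite lexx mulr0 addr0 co_norm_at_ge0.
  rewrite mulr1 co_norm_at_ge0/=.
  have pT : posdef (l T (chart_at X x) x).
    exact: (flow_posdef rf TT (dom_chart_at X x)).
  rewrite -(co_norm_self pT) /co_norm_at /sub_tensor.
  move: pT; move: (l T _ x) (initial_tensor _ x) => a b pT.
  rewrite -[X in X <= _]co_normN.
  apply: (@le_trans _ _ (co_norm a ((a - b) + - a))); first by rewrite addrAC subrr add0r.
  by rewrite (le_trans (co_normD _ _ pT))// co_normN.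
- by apply: ev => k s ks sk'; have [] := initial_tensor_Lnorm_le ks sk'.
- by apply: ev => k s ks sk'; have [] := initial_tensor_Lnorm_le ks sk'.
Unshelve. all: by end_near. Qed.

End InitialValue.

Theorem theorem2p5 (R : realType) (n : nat) (p : R) (hp : 2 <= p) :
  exists2 alpha0 : R, 0 < alpha0 &
  forall (M : ptopologicalType) (X : smooth_manifold R n M)
    (T eps : R) (l : R -> components X)
    (vol : R -> {measure set (borel M) -> \bar R}),
  0 < T -> eps <= alpha0 ->
  ricci_flow T l ->
  (forall t, 0 < t <= T -> volume_measure (l t) (vol t)) ->
  (forall t, 0 < t <= T ->
    (\int[vol t]_x (co_norm_at (l t) (ricci (l t)) x)%:E <= eps%:E)%E) ->
  (forall t, 0 < t <= T -> forall x : M,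
    co_norm_at (l t) (ricci (l t)) x <= eps / t) ->
  exists l0 : components X,
    (forall t, 0 < t <= T -> Lp_initial_value p l (l t) (vol t) l0) /\
    (forall t, 0 < t <= T -> forall h : components X,
      Lp_initial_value p l (l t) (vol t) h ->
      {ae vol t, forall x, h (chart_at X x) x = l0 (chart_at X x) x}).
Proof.
have p1 : 1 <= p by apply: le_trans hp; rewrite ler1n.
have q0 : 0 < 6 * p + n%:R.
  by rewrite ltr_pwDl// mulr_gt0// (lt_le_trans _ p1).
(* The p-norm of the Ricci tensor at time [t] is of order [t `^ (p^-1 - 1)] with
   respect to [l t], and contributes [t `^ p^-1] over a time interval of length
   comparable to [t].  Measuring with [l T] instead costs a factor
   [(T / t) `^ (al * (2 * p + n) / p)], and inverting the metrics another
   [(T / t) `^ (4 * al)].  This [al] makes their product [(T / t) `^ (2 * p)^-1]. *)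
pose al := (2 * (6 * p + n%:R))^-1.
have al0 : 0 < al by rewrite invr_gt0 mulr_gt0.
have alE : al * (6 * p + n%:R) = 2^-1.
  by rewrite /al invfM -mulrA mulVf ?mulr1// gt_eqF.
exists al => // M X T eps l vol T0 eps_al rf volE rint rpt.
have ricci_le t : 0 < t <= T -> forall x, co_norm_at (l t) (ricci (l t)) x <= al / t.
  move=> tT x; apply: le_trans (rpt t tT x) _.
  by case/andP: tT => t0 _; rewrite ler_pM2r ?invr_gt0.
have ricci_int t : 0 < t <= T ->
    (\int[vol t]_x (co_norm_at (l t) (ricci (l t)) x)%:E <= al%:E)%E.
  by move=> tT; apply: le_trans (rint t tT) _; rewrite lee_fin.
have l0P := initial_tensor_Lp rf T0 al0 ricci_le volE ricci_int p1 alE.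
have l0t t (tT : 0 < t <= T) := Lp_initial_value_transfer rf T0 ricci_le volE p1 tT l0P.
eexists; split; first exact: l0t.
move=> t tT h hL.
exact: (Lp_initial_value_unique rf T0 p1 tT hL (l0t t tT)).
Qed.
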